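(* Let $D'$ and $N'$ be coprime square-free positive integers such that $D'$ is the product of an odd number of primes, and let $m>1$ be an integer with $m\mid D'N'$. The following are equivalent. (1) There exist a definite quaternion algebra $B'$ over $\mathbf{Q}$ of discriminant $D'$, an Eichler order $\mathcal{O}'$ of level $N'$ in $B'$, and elements $\omega_1,\omega_2\in\mathcal{O}'$ with $\omega_1^2=-1$ and $\omega_2^2=-m$. (2) Writing $D'=\prod_i p_i$ and $N'=\prod_j q_j$ as products of distinct primes: either $m=D'N'$, or $2\mid D'N'$ and $m=D'N'/2$; for every $i$, $p_i=2$ or $p_i\equiv 3\pmod 4$; and for every $j$, $q_j=2$ or $q_j\equiv 1\pmod 4$.
   Context: The discriminant of a quaternion algebra $B$ over $\mathbf{Q}$ is the product of the finite primes at which $B$ is ramified; $B$ is definite if it is ramified at $\infty$ (equivalently, its discriminant is a product of an odd number of primes). An order is a subring of rank $4$ over $\mathbf{Z}$ spanning $B$; an Eichler order is an intersection of two maximal orders, and its level is its index in either of them. For square-free level $N'$ coprime to $D'$, these are the orders of reduced discriminant $D'N'$. *)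

(* Defs.v *)
From HB Require Import structures.
From mathcomp Require Import all_boot all_order all_algebra all_field.
From mathcomp Require Import boolp classical_sets reals Rstruct.
From mathcomp Require Import ring.

Set Implicit Arguments.
Unset Strict Implicit.
Unset Printing Implicit Defensive.

Import GRing.Theory.

Local Open Scope ring_scope.

Definition squarefree (n : nat) : Prop :=
  forall p : nat, prime p -> ~~ (p ^ 2 %| n)%N.

(* An element of the inverse limit of the rings Z/p^n, its component in Z/p^n
   being given by its representative in [0, p^n[. *)
Record padic_int (p : nat) (pp : prime p) := PadicInt {
  padic_res :> nat -> nat;
  padic_resP : forall n, padic_res n = (padic_res n.+1 %% p ^ n)%N }.

HB.instance Definition _ p (pp : prime p) := gen_eqMixin (padic_int pp).
HB.instance Definition _ p (pp : prime p) := gen_choiceMixin (padic_int pp).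

Section PadicInt.
Local Open Scope nat_scope.
Variables (p : nat) (pp : prime p).
Local Notation Zp := (padic_int pp).
Implicit Types x y z : Zp.

Lemma padic_eq x y : (forall n, x n = y n) -> x = y.
Proof.
case: x y => [f Hf] [g Hg] /= /funext fg; subst g.
by rewrite (Prop_irrelevance Hf Hg).
Qed.

Lemma padic_resE x m n : m <= n -> x m = x n %% p ^ m.
Proof.
elim: n => [|n IHn]; first by rewrite leqn0 => /eqP->; rewrite {1}padic_resP !modn1.
rewrite leq_eqVlt => /predU1P[->|]; last first.
  by rewrite ltnS => mn; rewrite IHn // (padic_resP x n) modn_dvdm // dvdn_exp2l.
by rewrite (padic_resP x n.+1) modn_mod.
Qed.

Lemma padic_mod x n : x n %% p ^ n = x n.
Proof. by rewrite -(padic_resE x (leqnn n)). Qed.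

Fact padic_mk_subproof (f : nat -> nat) :
  (forall n, f n.+1 = f n %[mod p ^ n]) ->
  forall n, f n %% p ^ n = (f n.+1 %% p ^ n.+1) %% p ^ n.
Proof. by move=> Hf n; rewrite modn_dvdm ?dvdn_exp2l // Hf. Qed.

Definition padic_mk f Hf : Zp := PadicInt pp (@padic_mk_subproof f Hf).

Fact padic_const_subproof (c n : nat) : c = c %[mod p ^ n].
Proof. by []. Qed.
Definition padic_const (c : nat) : Zp := padic_mk (padic_const_subproof c).

Fact padic_add_subproof x y n : x n.+1 + y n.+1 = x n + y n %[mod p ^ n].
Proof. by rewrite (padic_resP x n) (padic_resP y n) modnDm. Qed.
Definition padic_add x y : Zp := padic_mk (padic_add_subproof x y).

Fact padic_mul_subproof x y n : x n.+1 * y n.+1 = x n * y n %[mod p ^ n].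
Proof. by rewrite (padic_resP x n) (padic_resP y n) modnMm. Qed.
Definition padic_mul x y : Zp := padic_mk (padic_mul_subproof x y).

Fact padic_opp_subproof x n :
  x n.+1 * (p ^ n.+1).-1 = x n * (p ^ n).-1 %[mod p ^ n].
Proof.
rewrite (padic_resP x n) modnMml; apply/eqP.
rewrite -(eqn_modDr (x n.+1)) -!mulnSr !prednK ?expn_gt0 ?prime_gt0 //.
by rewrite expnS mulnCA !modnMl mulnA modnMl.
Qed.
Definition padic_opp x : Zp := padic_mk (padic_opp_subproof x).

Fact padic_addA : associative padic_add.
Proof. by move=> x y z; apply: padic_eq => n /=; rewrite modnDmr modnDml addnA. Qed.
Fact padic_addC : commutative padic_add.
Proof. by move=> x y; apply: padic_eq => n /=; rewrite addnC. Qed.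
Fact padic_add0 : left_id (padic_const 0) padic_add.
Proof. by move=> x; apply: padic_eq => n /=; rewrite mod0n padic_mod. Qed.
Fact padic_addN : left_inverse (padic_const 0) padic_opp padic_add.
Proof.
move=> x; apply: padic_eq => n /=.
by rewrite modnDml -mulnSr prednK ?expn_gt0 ?prime_gt0 // modnMl mod0n.
Qed.
Fact padic_mulA : associative padic_mul.
Proof. by move=> x y z; apply: padic_eq => n /=; rewrite modnMmr modnMml mulnA. Qed.
Fact padic_mulC : commutative padic_mul.
Proof. by move=> x y; apply: padic_eq => n /=; rewrite mulnC. Qed.
Fact padic_mul1 : left_id (padic_const 1) padic_mul.
Proof. by move=> x; apply: padic_eq => n /=; rewrite modnMml mul1n padic_mod. Qed.
Fact padic_mulD : left_distributive padic_mul padic_add.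
Proof.
by move=> x y z; apply: padic_eq => n /=; rewrite modnMml modnDm mulnDl.
Qed.
Fact padic_1neq0 : padic_const 1 != padic_const 0.
Proof.
apply/eqP => /(congr1 (fun x : Zp => x 1)) /=.
by rewrite mod0n modn_small // expn1 prime_gt1.
Qed.

HB.instance Definition _ :=
  GRing.isZmodule.Build Zp padic_addA padic_addC padic_add0 padic_addN.
HB.instance Definition _ := GRing.Zmodule_isComNzRing.Build Zp
  padic_mulA padic_mulC padic_mul1 padic_mulD padic_1neq0.

Definition padic_unit : {pred Zp} := fun x => `[< exists y : Zp, (y * x = 1)%R >].
Definition padic_inv x : Zp :=
  if pselect (exists y : Zp, (y * x = 1)%R) is left xU then sval (cid xU) else x.

Fact padic_mulV : {in padic_unit, left_inverse 1%R padic_inv *%R}.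
Proof.
move=> x /asboolP xU; rewrite /padic_inv; case: pselect => // yx.
exact: svalP (cid yx).
Qed.
Fact padic_unitPl x y : (y * x = 1)%R -> padic_unit x.
Proof. by move=> yx; apply/asboolP; exists y. Qed.
Fact padic_inv_out : {in [predC padic_unit], padic_inv =1 id}.
Proof.
move=> x /negP xU; rewrite /padic_inv; case: pselect => // yx.
by case: xU; apply/asboolP.
Qed.
HB.instance Definition _ := GRing.ComNzRing_hasMulInverse.Build Zp
  padic_mulV padic_unitPl padic_inv_out.

Lemma padic_neq0 x : x != 0%R -> exists n, forall N, n <= N -> ~~ (p ^ n %| x N).
Proof.
move=> x0; have [n xn] : exists n, x n != 0.
  apply: contrapT => H; case/eqP: x0; apply: padic_eq => n /=.
  by rewrite mod0n; apply/eqP; apply: contrapT => /negP xn; apply: H; exists n.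
exists n => N nN; apply: contra xn => /eqP.
by rewrite -padic_resE // => ->.
Qed.

Fact padic_integral : GRing.integral_domain_axiom Zp.
Proof.
move=> x y xy0; apply/norP => -[/padic_neq0[m Hx] /padic_neq0[n Hy]].
have := congr1 (fun z : Zp => z (m + n)) xy0 => /=; rewrite mod0n => /eqP.
have {Hx}Hx := Hx _ (leq_addr n m); have {Hy}Hy := Hy _ (leq_addl m n).
have [x0|x0] := posnP (x (m + n)); first by rewrite x0 dvdn0 in Hx.
have [y0|y0] := posnP (y (m + n)); first by rewrite y0 dvdn0 in Hy.
rewrite -/(p ^ (m + n) %| _) pfactor_dvdn ?muln_gt0 ?x0 // lognM //.
rewrite pfactor_dvdn // -ltnNge in Hx; rewrite pfactor_dvdn // -ltnNge in Hy.
by rewrite leqNgt -addSn leq_add // ltnW.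
Qed.
HB.instance Definition _ := GRing.ComUnitRing_isIntegral.Build Zp padic_integral.

End PadicInt.

Definition padic (p : nat) (pp : prime p) : fieldType := {fraction padic_int pp}.

(* The algebra (a, b | F), a vector [:: x0; x1; x2; x3] standing for
   x0 + x1 i + x2 j + x3 k, where i^2 = a, j^2 = b and k = i j = - j i.
   It is a quaternion algebra over F when F has characteristic other than 2
   and a and b are nonzero. *)
Definition quat (F : fieldType) (a b : F) : Type := 'rV[F]_4.

HB.instance Definition _ (F : fieldType) (a b : F) := Vector.on (quat a b).

Section Quat.
Variables (F : fieldType) (a b : F).
Local Notation Q := (quat a b).

Definition quat_of_seq (s : seq F) : Q := \row_(i < 4) s`_i.

Definition quat_one : Q := quat_of_seq [:: 1; 0; 0; 0].

Definition quat_mul (x y : Q) : Q :=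
  let x0 := x 0 (inord 0) in let x1 := x 0 (inord 1) in
  let x2 := x 0 (inord 2) in let x3 := x 0 (inord 3) in
  let y0 := y 0 (inord 0) in let y1 := y 0 (inord 1) in
  let y2 := y 0 (inord 2) in let y3 := y 0 (inord 3) in
  quat_of_seq
    [:: x0 * y0 + a * x1 * y1 + b * x2 * y2 - a * b * x3 * y3;
        x0 * y1 + x1 * y0 - b * x2 * y3 + b * x3 * y2;
        x0 * y2 + x2 * y0 + a * x1 * y3 - a * x3 * y1;
        x0 * y3 + x3 * y0 + x1 * y2 - x2 * y1].

Lemma quat_eq (x y : Q) :
  x 0 (inord 0) = y 0 (inord 0) -> x 0 (inord 1) = y 0 (inord 1) ->
  x 0 (inord 2) = y 0 (inord 2) -> x 0 (inord 3) = y 0 (inord 3) -> x = y.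
Proof.
move=> e0 e1 e2 e3; apply/rowP => i; rewrite -(inord_val i).
by case: i => [[|[|[|[|]]]]].
Qed.

Let quatE := (mxE, inordK).

Fact quat_mulA : associative quat_mul.
Proof. by move=> x y z; apply: quat_eq; rewrite !quatE //=; ring. Qed.
Fact quat_mul1l : left_id quat_one quat_mul.
Proof. by move=> x; apply: quat_eq; rewrite !quatE //=; ring. Qed.
Fact quat_mul1r : right_id quat_one quat_mul.
Proof. by move=> x; apply: quat_eq; rewrite !quatE //=; ring. Qed.
Fact quat_mulDl : left_distributive quat_mul (@GRing.add Q).
Proof. by move=> x y z; apply: quat_eq; rewrite !quatE //=; ring. Qed.
Fact quat_mulDr : right_distributive quat_mul (@GRing.add Q).
Proof. by move=> x y z; apply: quat_eq; rewrite !quatE //=; ring. Qed.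
Fact quat_1neq0 : quat_one != 0.
Proof.
apply/eqP => /(congr1 (fun x : Q => x 0 (inord 0))) /eqP.
by rewrite !quatE //= oner_eq0.
Qed.
HB.instance Definition _ := GRing.Zmodule_isNzRing.Build Q
  quat_mulA quat_mul1l quat_mul1r quat_mulDl quat_mulDr quat_1neq0.

Fact quat_scaleAl (c : F) (x y : Q) : c *: (x * y) = c *: x * y.
Proof. by apply: quat_eq; rewrite !quatE //=; ring. Qed.
HB.instance Definition _ := GRing.Lmodule_isLalgebra.Build F Q quat_scaleAl.

Fact quat_scaleAr (c : F) (x y : Q) : c *: (x * y) = x * (c *: y).
Proof. by apply: quat_eq; rewrite !quatE //=; ring. Qed.
HB.instance Definition _ := GRing.Lalgebra_isAlgebra.Build F Q quat_scaleAr.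
HB.instance Definition _ := Algebra_isFalgebra.Build F Q.

End Quat.

Definition division_algebra (F : fieldType) (A : falgType F) : Prop :=
  forall x : A, x != 0 -> x \is a GRing.unit.

(* For B = (a, b | Q) the completion of B at a place v, that is the tensor
   product of B with Q_v, is (a, b | Q_v); B is ramified at v when this
   completion is a division algebra. *)
Definition ramified_at (a b : rat) (p : nat) : Prop :=
  exists pp : prime p,
    division_algebra (quat (ratr a : padic pp) (ratr b : padic pp)).

Definition definite (a b : rat) : Prop :=
  division_algebra
    (quat (ratr a : Rdefinitions.R) (ratr b : Rdefinitions.R)).

Definition has_discriminant (a b : rat) (D : nat) : Prop :=
  exists s : seq nat,
    [/\ uniq s, forall p : nat, p \in s <-> ramified_at a b p
      & D = (\prod_(p <- s) p)%N].

Section Orders.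
Local Open Scope classical_set_scope.
Variable A : falgType rat.
Implicit Types O : set A.

Definition is_order O : Prop :=
  [/\ O 1, forall x y, O x -> O y -> O (x - y),
      forall x y, O x -> O y -> O (x * y)
    & exists2 e : (\dim {:A}).-tuple A, basis_of {:A} e
        & O = [set x | exists z : 'I_(\dim {:A}) -> int,
                         x = \sum_(i < \dim {:A}) e`_i *~ z i]].

Definition maximal_order O : Prop :=
  is_order O /\ forall O', is_order O' -> O `<=` O' -> O' = O.

(* [s] is a system of representatives of O / O'. *)
Definition has_index O O' (N : nat) : Prop :=
  exists s : seq A,
    [/\ size s = N, forall x, x \in s -> O x,
        forall i j, (i < N)%N -> (j < N)%N -> O' (s`_i - s`_j) -> i = j
      & forall x, O x -> exists2 y, y \in s & O' (x - y)].

Definition eichler_order O (N : nat) : Prop :=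
  exists O1 O2 : set A,
    [/\ maximal_order O1, maximal_order O2, O = O1 `&` O2,
        has_index O1 O N & has_index O2 O N].

End Orders.

(* Main.v *)
From HB Require Import structures.
Require Import Defs.
From mathcomp Require Import all_boot all_order all_algebra all_field.
From mathcomp Require Import boolp classical_sets.
From mathcomp Require Import Rstruct.
From mathcomp Require Import ring zify.

(* Put t = w1 w2 + w2 w1, an integer, and c = 4m - t^2.  As w1 and 2 w2 + t w1
   anticommute, the algebra is (-1, -c), and c > 0 since it is definite.  It
   splits at every prime not dividing c, so every prime of D divides c; and c
   times a maximal order containing w1 and w2 lies in the order they generate,
   so every prime of N divides c as well.  Hence D N divides 4m - t^2, which
   together with m | D N determines m; the congruences say where (-1, -m) is
   ramified.
   Conversely let d and n be the odd parts of D and N and work in (-1, -d n).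
   A square root x of -1 modulo n gives the integral element (k - x j) / n, which
   generates together with i, j and suitable halves a maximal order.  Its
   intersection with a conjugate has level N and contains i, j and j - k, and
   (j - k)^2 = - 2 d n. *)

Set Implicit Arguments.
Unset Strict Implicit.
Unset Printing Implicit Defensive.

Import Order.TTheory GRing.Theory Num.Theory.

(** * Quaternion algebras: coordinates, reduced norm, change of generators *)

(** The only local computation is the ramification test, reduced to zeros of the norm form;
    everything else uses traces and norms inside a global order. Knowing that [c] kills O1 / O gives
    no more than N | c^4, so only the primes of N are controlled, and square-freeness recovers N |
    c. In the converse the parity of the number of primes of d fixes d n modulo 4: it is 3 when D is
    odd and 1 when D is even, and this residue decides whether (-1, -d n) ramifies at 2. Integrality
    of the halves then depends on it, which is why there are two lattices, one for even x and one
    for odd x. Maximality is proved by duality: an element of a larger order has integral traces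
    against the lattice, which bounds its denominators up to a factor d; the integral norm removes d
    because -1 is not a square modulo any prime of d. The factor 2 of an even level comes from the
    choice of the conjugate: conjugating by j gives level n, by (1 + i) j level 2 n. A single order
    contains both j and j - k, so it serves m = d n and m = 2 d n alike. *)

Section QuatTheory.
Local Open Scope ring_scope.
Variables (F : fieldType) (a b : F).
Local Notation Q := (quat a b).
Implicit Types x y : Q.

Definition qc (i : nat) x : F := x 0 (inord i).

Definition mkq (c0 c1 c2 c3 : F) : Q := quat_of_seq a b [:: c0; c1; c2; c3].

Lemma mkqE c0 c1 c2 c3 : (qc 0 (mkq c0 c1 c2 c3) = c0)
  * (qc 1 (mkq c0 c1 c2 c3) = c1) * (qc 2 (mkq c0 c1 c2 c3) = c2)
  * (qc 3 (mkq c0 c1 c2 c3) = c3).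
Proof. by rewrite /qc !mxE !inordK. Qed.

Lemma quatP x y : [/\ qc 0 x = qc 0 y, qc 1 x = qc 1 y, qc 2 x = qc 2 y
  & qc 3 x = qc 3 y] <-> x = y.
Proof. by split=> [[]|->//]; exact: quat_eq. Qed.

Lemma qcD i x y : qc i (x + y) = qc i x + qc i y.
Proof. by rewrite /qc mxE. Qed.
Lemma qcN i x : qc i (- x) = - qc i x. Proof. by rewrite /qc mxE. Qed.
Lemma qcZ i c x : qc i (c *: x) = c * qc i x. Proof. by rewrite /qc mxE. Qed.
Lemma qc0 i : qc i (0 : Q) = 0. Proof. by rewrite /qc mxE. Qed.

Lemma qc1 : (qc 0 (1 : Q) = 1) * (qc 1 (1 : Q) = 0) * (qc 2 (1 : Q) = 0)
  * (qc 3 (1 : Q) = 0).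
Proof. by rewrite /qc !mxE !inordK. Qed.

Lemma qcM x y :
  (qc 0 (x * y) = qc 0 x * qc 0 y + a * qc 1 x * qc 1 y + b * qc 2 x * qc 2 y
                  - a * b * qc 3 x * qc 3 y)
  * (qc 1 (x * y) = qc 0 x * qc 1 y + qc 1 x * qc 0 y - b * qc 2 x * qc 3 y
                  + b * qc 3 x * qc 2 y)
  * (qc 2 (x * y) = qc 0 x * qc 2 y + qc 2 x * qc 0 y + a * qc 1 x * qc 3 y
                  - a * qc 3 x * qc 1 y)
  * (qc 3 (x * y) = qc 0 x * qc 3 y + qc 3 x * qc 0 y + qc 1 x * qc 2 y
                  - qc 2 x * qc 1 y).
Proof. by rewrite /qc !mxE !inordK. Qed.

Definition qE := (mkqE, qcM, qc1, qcD, qcN, qcZ, qc0).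

Definition qconj x : Q := mkq (qc 0 x) (- qc 1 x) (- qc 2 x) (- qc 3 x).

Definition nrd x : F :=
  qc 0 x ^+ 2 - a * qc 1 x ^+ 2 - b * qc 2 x ^+ 2 + a * b * qc 3 x ^+ 2.

Definition trd x : F := qc 0 x + qc 0 x.

Lemma mulq_conj x : x * qconj x = (nrd x)%:A.
Proof. by apply/quatP; rewrite !qE /nrd; split; ring. Qed.

Lemma mul_conjq x : qconj x * x = (nrd x)%:A.
Proof. by apply/quatP; rewrite !qE /nrd; split; ring. Qed.

Lemma quat_sqr x : x * x = trd x *: x - (nrd x)%:A.
Proof. by apply/quatP; rewrite !qE /nrd /trd; split; ring. Qed.

Lemma qconj_eq0 x : (qconj x == 0) = (x == 0).
Proof.
apply/eqP/eqP => [/quatP|->].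
  rewrite !qE => -[e0 /eqP e1 /eqP e2 /eqP e3]; apply/quatP; rewrite !qE.
  by rewrite !oppr_eq0 in e1 e2 e3; split=> //; apply/eqP.
by apply/quatP; rewrite !qE oppr0.
Qed.

(** The inverse of [x] is its conjugate divided by its norm. All ramification questions below are
    settled through zeros of the norm form. *)
Lemma division_quatP :
  division_algebra Q <-> forall x, nrd x = 0 -> x = 0.
Proof.
split=> [dQ x nx|aQ x x0].
  apply/eqP; apply: contraT => /dQ ux.
  have := mulq_conj x; rewrite nx scale0r => /(congr1 (fun y => x^-1 * y)).
  rewrite mulrA mulVr // mul1r mulr0 => /eqP; rewrite qconj_eq0 => /eqP x0.
  by move: ux; rewrite x0 unitr0.
have nx : nrd x != 0 by apply: contra x0 => /eqP/aQ ->.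
apply/unitrP; exists ((nrd x)^-1 *: qconj x).
by rewrite -scalerAl -scalerAr mulq_conj mul_conjq scalerA mulVf // scale1r.
Qed.

End QuatTheory.

Lemma sum_ord4 (V : nmodType) (f : 'I_4 -> V) :
  (\sum_(i < 4) f i
     = f (inord 0) + f (inord 1) + f (inord 2) + f (inord 3))%R.
Proof.
rewrite !big_ord_recl big_ord0 addr0 !addrA.
by do 3?congr (_ + _)%R; congr f; apply/val_inj; rewrite /= inordK.
Qed.

(** * Presenting the algebra by another anticommuting pair *)

Section Embedding.
Local Open Scope ring_scope.
Variables (F : fieldType) (a b al be : F) (W1 W2 : quat a b).
Hypotheses (two0 : (2%:R : F) != 0) (al0 : al != 0) (be0 : be != 0).
Hypotheses (W11 : W1 * W1 = al%:A) (W22 : W2 * W2 = be%:A).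
Hypothesis W21 : W2 * W1 = - (W1 * W2).
Let W3 := W1 * W2.

(** The algebra map sending i, j, k to [W1], [W2], [W1 * W2]. Its multiplicativity enters through
    the product of [x] and its conjugate, which carries the norm ([qembed_conj]). *)
Definition qembed (x : quat al be) : quat a b :=
  (qc 0 x)%:A + qc 1 x *: W1 + qc 2 x *: W2 + qc 3 x *: W3.

Let W12 : W1 * W2 = W3. Proof. by []. Qed.
Let W13 : W1 * W3 = al *: W2.
Proof. by rewrite /W3 mulrA W11 -scalerAl mul1r. Qed.
Let W32 : W3 * W2 = be *: W1.
Proof. by rewrite /W3 -mulrA W22 -scalerAr mulr1. Qed.
Let W23 : W2 * W3 = - (be *: W1).
Proof. by rewrite /W3 mulrA W21 mulNr W32. Qed.
Let W31 : W3 * W1 = - (al *: W2).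
Proof. by rewrite /W3 -mulrA W21 mulrN W13. Qed.
Let W33 : W3 * W3 = - (al * be)%:A.
Proof. by rewrite {1}/W3 -mulrA W23 mulrN -scalerAr W11 scalerA mulrC. Qed.

Let lincomb (u v : quat a b) : (forall i, u 0 i = v 0 i) -> u = v.
Proof. by move=> uv; apply/rowP. Qed.

Lemma qembed_conj x : qembed x * qembed (qconj x) = (nrd x)%:A.
Proof.
rewrite /qembed !qE !mulrDl !mulrDr -!(scalerAl, scalerAr).
rewrite !(mul1r, mulr1, W11, W22, W12, W21, W13, W31, W23, W32, W33).
rewrite /nrd; move: (1 : quat a b) W3 => o w; apply: lincomb => i.
by rewrite !mxE; ring.
Qed.

Let two_eq0 (v : quat a b) : v + v = 0 -> v = 0.
Proof.
move=> vv; apply/eqP; have: 2%:R *: v == 0 by rewrite scaler_nat mulr2n vv.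
by rewrite scaler_eq0 (negPf two0).
Qed.

(** Multiplying by [W2] on both sides changes the sign of the [W1] part, up to the factor [be];
    adding the two relations isolates [u0]. *)
Let indep1 (u0 u1 : F) : u0%:A + u1 *: W1 = 0 -> u0 = 0 /\ u1 = 0.
Proof.
move=> uW; have uW' : u0%:A - u1 *: W1 = 0.
  apply/eqP; have: be *: (u0%:A - u1 *: W1) == 0.
    suff <- : W2 * (u0%:A + u1 *: W1) * W2 = be *: (u0%:A - u1 *: W1).
      by rewrite uW mulr0 mul0r.
    rewrite mulrDr mulrDl -!(scalerAl, scalerAr) mulr1 W22 W21 W12 mulNr W32.
    by move: (1 : quat a b) W3 => o w; apply: lincomb => i; rewrite !mxE; ring.
  by rewrite scaler_eq0 (negPf be0).
have u00 : u0 = 0.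
  have : u0%:A = 0 :> quat a b.
    apply: two_eq0.
    have -> : u0%:A + u0%:A = (u0%:A + u1 *: W1) + (u0%:A - u1 *: W1) :> quat a
      b.
      by rewrite [RHS]addrACA subrr addr0.
    by rewrite uW uW' addr0.
  by move/quatP=> []; rewrite !qE mulr1.
split=> //; move: uW; rewrite u00 scale0r add0r => /eqP.
rewrite scaler_eq0 => /predU1P[//|/eqP W10].
by move: W11; rewrite W10 mul0r => /quatP[]; rewrite !qE mulr1 => /esym/eqP;
  rewrite (negPf al0).
Qed.

Lemma qembed_inj x : qembed x = 0 -> x = 0.
Proof.
move=> x0.
set u := (qc 0 x)%:A + qc 1 x *: W1; set v := qc 2 x *: W2 + qc 3 x *: W3.
have uv : u + v = 0 by rewrite -x0 /qembed -!addrA.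
(* [u] commutes with [W1] and [v] anticommutes with it, so multiplying by [W1] on both sides
   separates them. *)
have uv' : u - v = 0.
  apply/eqP; have: al *: (u - v) == 0.
    suff <- : W1 * (u + v) * W1 = al *: (u - v) by rewrite uv mulr0 mul0r.
    rewrite /u /v !mulrDr !mulrDl -!(scalerAl, scalerAr) mulr1 !(W11, W13).
    rewrite W12 -!(scalerAl, scalerAr) mul1r W31 W21 W12.
    by move: (1 : quat a b) W3 => o w; apply: lincomb => i; rewrite !mxE; ring.
  by rewrite scaler_eq0 (negPf al0).
have u0 : u = 0.
  apply: two_eq0; have -> : u + u = (u + v) + (u - v).
    by rewrite [RHS]addrACA subrr addr0.
  by rewrite uv uv' addr0.
have v0 : v = 0 by rewrite u0 add0r in uv.
have [e0 e1] := indep1 u0.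
(* Up to the factor [be], the product [v * W2] has the shape treated by [indep1]. *)
have [e2 e3] : qc 2 x = 0 /\ qc 3 x = 0.
  apply: indep1; have /eqP : be *: ((qc 2 x)%:A + qc 3 x *: W1) = 0.
    rewrite -[RHS](mul0r W2) -v0 /v mulrDl -!scalerAl W22 W32.
    by move: (1 : quat a b) W3 => o w; apply: lincomb => i; rewrite !mxE; ring.
  by rewrite scaler_eq0 (negPf be0) => /eqP.
by apply/quatP; rewrite e0 e1 e2 e3 !qE.
Qed.

Lemma qembed_surj y : exists x, qembed x = y.
Proof.
pose M : 'M[F]_4 :=
  \matrix_(i, j) (nth 0 [:: 1; W1; W2; W3] i : quat a b) 0 j.
have ME (x : quat al be) : x *m M = qembed x.
  rewrite /M /qembed; move: (1 : quat a b) W3 => o w; apply/rowP => j.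
  by rewrite mxE sum_ord4 !mxE !inordK.
have Mfree : row_free M.
  by apply: inj_row_free => v; rewrite ME => /qembed_inj.
have Mfull : row_full M by rewrite row_full_unit -row_free_unit.
by exists (y *m invmx M); rewrite -ME mulmxKV // -row_free_unit.
Qed.

(** The embedding is bijective and compatible with norms, so anisotropy passes both ways. This is
    what brings every algebra below to the form (-1, c). *)
Lemma division_qembed :
  division_algebra (quat a b) <-> division_algebra (quat al be).
Proof.
split=> [dQ|/division_quatP dA]; apply/division_quatP.
  move=> x nx; apply: qembed_inj; apply/eqP; apply: contraT => /dQ ux.
  have /(congr1 (fun v => (qembed x)^-1 * v)) := qembed_conj x.
  rewrite nx scale0r mulrA mulVr // mul1r mulr0 => /qembed_inj/eqP.
  rewrite qconj_eq0 => /eqP x0; move: ux; rewrite x0 /qembed !qE.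
  by rewrite !scale0r !addr0 unitr0.
move=> y ny; have [x xy] := qembed_surj y.
apply/eqP; apply: contraT => y0; case/eqP: (y0).
have nx : nrd x != 0.
  apply: contra y0 => /eqP/dA x0.
  by rewrite -xy x0 /qembed !qE !scale0r !addr0.
have := congr1 (fun v => qconj y * v) (qembed_conj x).
rewrite xy mulrA mul_conjq ny scale0r mul0r -scalerAr mulr1 => /esym/eqP.
by rewrite scaler_eq0 (negPf nx) qconj_eq0 => /eqP.
Qed.
End Embedding.

(** * Base change and congruences in the p-adic integers *)

Section BaseChange.
Local Open Scope ring_scope.

Section RatrRMorph.
Variable K : fieldType.
Hypothesis K0 : forall n : nat, (n.+1%:R : K) != 0.

Let intr0 (z : int) : z != 0 -> z%:~R != 0 :> K.
Proof.
case: z => [[|n]|n] // _; first exact: K0.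
by rewrite NegzE mulrNz oppr_eq0 K0.
Qed.

(** [ratr] is computed from the reduced fraction; evaluating it from an arbitrary one makes
    additivity and multiplicativity a matter of clearing denominators. *)
Lemma ratr_frac (x : rat) (n d : int) :
  x * d%:~R = n%:~R -> ratr x * d%:~R = n%:~R :> K.
Proof.
move=> xdn; have den0 : (denq x)%:~R != 0 :> rat by rewrite intr_eq0 denq_eq0.
have E : numq x * d = n * denq x.
  have numE : x * (denq x)%:~R = (numq x)%:~R.
    by rewrite -{1}(divq_num_den x) divfK.
  by apply: (@intr_inj rat); rewrite !rmorphM /= -xdn -numE; ring.
have den0' : (denq x)%:~R != 0 :> K by rewrite intr0 ?denq_eq0.
apply: (mulIf den0'); rewrite -rmorphM /= -E rmorphM /= /ratr.
by rewrite mulrAC divfK.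
Qed.

(** Stated for every field where positive integers are nonzero, so that it covers the p-adic fields
    as well as the reals. *)
Lemma ratr_rmorph : exists f : {rmorphism rat -> K}, f =1 ratr.
Proof.
have den0 (x : rat) : (denq x)%:~R != 0 :> K by rewrite intr0 ?denq_eq0.
have numE (x : rat) : ratr x * (denq x)%:~R = (numq x)%:~R :> K.
  by rewrite /ratr divfK.
have numE' (x : rat) : x * (denq x)%:~R = (numq x)%:~R.
  by rewrite -{1}(divq_num_den x) divfK // intr_eq0 denq_eq0.
have rB : zmod_morphism (@ratr K).
  move=> x y; apply: (mulIf (mulf_neq0 (den0 x) (den0 y))).
  rewrite -rmorphM /= (@ratr_frac _ (numq x * denq y - numq y * denq x)).
    by rewrite rmorphB !rmorphM /= -!numE; ring.
  by rewrite rmorphB !rmorphM /= -!numE'; ring.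
have rM : monoid_morphism (@ratr K).
  split=> [|x y]; first by have := @ratr_frac 1 1 1 erefl; rewrite mulr1.
  apply: (mulIf (mulf_neq0 (den0 x) (den0 y))).
  rewrite -rmorphM /= (@ratr_frac _ (numq x * numq y)).
    by rewrite !rmorphM /= -!numE; ring.
  by rewrite !rmorphM /= -!numE'; ring.
pose f1 := GRing.isZmodMorphism.Build rat K (@ratr K) rB.
pose f2 := GRing.isMonoidMorphism.Build rat K (@ratr K) rM.
pose f : {rmorphism rat -> K} := HB.pack (@ratr K) f1 f2.
by exists f.
Qed.

End RatrRMorph.

Variables (F K : fieldType) (f : {rmorphism F -> K}) (a b : F).

Definition qmap (x : quat a b) : quat (f a) (f b) :=
  mkq _ _ (f (qc 0 x)) (f (qc 1 x)) (f (qc 2 x)) (f (qc 3 x)).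

Lemma qmapM x y : qmap (x * y) = qmap x * qmap y.
Proof.
by apply/quatP; rewrite !qE !(rmorphD, rmorphN, rmorphM).
Qed.

Lemma qmapN x : qmap (- x) = - qmap x.
Proof. by apply/quatP; rewrite !qE !rmorphN. Qed.

Lemma qmap_scalar c : qmap (c%:A) = (f c)%:A.
Proof. by apply/quatP; rewrite !qE !mulr1 !mulr0 rmorph0. Qed.

Lemma division_qmap (al be : F) (W1 W2 : quat a b) :
  2%:R != 0 :> F -> al != 0 -> be != 0 -> W1 * W1 = al%:A -> W2 * W2 = be%:A ->
  W2 * W1 = - (W1 * W2) ->
  division_algebra (quat (f a) (f b)) <-> division_algebra (quat (f al) (f be)).
Proof.
move=> n2 al0 be0 W11 W22 W21.
apply: (@division_qembed _ _ _ _ _ (qmap W1) (qmap W2)); rewrite ?fmorph_eq0 //.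
- by rewrite -(rmorph_nat f) fmorph_eq0.
- by rewrite -qmapM W11 qmap_scalar.
- by rewrite -qmapM W22 qmap_scalar.
- by rewrite -!qmapM W21 qmapN.
Qed.

End BaseChange.

(** * Hensel lifting through integer congruences *)

Section PadicCongruence.
Local Open Scope ring_scope.
Variables (p : nat) (pp : prime p).
Local Notation Zp := (padic_int pp).
Implicit Types (x y : Zp) (k : nat) (z t : int).

(** Congruence modulo p^k between a p-adic integer and a rational integer; taking [z] in [int] lets
    subtraction and Newton iteration happen on integers. *)
Definition pcong x k z : bool := (Posz (p ^ k) %| Posz (x k) - z)%Z.

Lemma pcong_trans x k z t :
  pcong x k z -> (Posz (p ^ k) %| z - t)%Z -> pcong x k t.
Proof. by rewrite /pcong -!eqz_mod_dvd => /eqP-> /eqP->. Qed.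

Lemma pcongD x y k z t : pcong x k z -> pcong y k t -> pcong (x + y) k (z + t).
Proof.
rewrite /pcong /= -!eqz_mod_dvd => /eqP xz /eqP yt.
by rewrite -modz_nat PoszD modz_mod -modzDm xz yt modzDm.
Qed.

Lemma pcongM x y k z t : pcong x k z -> pcong y k t -> pcong (x * y) k (z * t).
Proof.
rewrite /pcong /= -!eqz_mod_dvd => /eqP xz /eqP yt.
by rewrite -modz_nat PoszM modz_mod -modzMm xz yt modzMm.
Qed.

Lemma pcong_nat k (n : nat) : pcong n%:R k n.
Proof.
elim: n => [|n IHn]; first by rewrite /pcong /= mod0n subr0 dvdz0.
rewrite mulrS -addn1 addnC PoszD; apply: pcongD => //.
by rewrite /pcong /= -eqz_mod_dvd -modz_nat modz_mod.
Qed.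

Lemma pcongN x k z : pcong x k z -> pcong (- x) k (- z).
Proof.
rewrite /pcong => xz.
have := congr1 (fun u : Zp => Posz (u k)) (subrr x).
rewrite [(0 : Zp) k]/= mod0n [(_ + _ : Zp) k]/= -modz_nat PoszD => /dvdz_mod0P
  xN.
rewrite (_ : _ - _ = (Posz (x k) + Posz ((- x : Zp) k)) - (Posz (x k) - z));
  last ring.
by rewrite rpredB.
Qed.

Lemma pcong_int k z : pcong z%:~R k z.
Proof.
case: z => n; first exact: pcong_nat.
by rewrite NegzE mulrNz; apply/pcongN/pcong_nat.
Qed.

Lemma pcong_refl x k : pcong x k (x k).
Proof. by rewrite /pcong subrr dvdz0. Qed.

Lemma pcong_eq0 x : (forall k, pcong x k 0) -> x = 0.
Proof.
move=> x0; apply: padic_eq => k; have := x0 k; rewrite /pcong subr0 dvdzE.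
by move=> /eqP xk; rewrite /= mod0n -[LHS]padic_mod.
Qed.

Lemma pcong0 k z : pcong 0 k z = (Posz (p ^ k) %| z)%Z.
Proof. by rewrite /pcong /= mod0n sub0r rpredN. Qed.

Lemma pcong_res x k l : (k <= l)%N -> pcong x k (x l).
Proof.
by move=> kl; rewrite /pcong (padic_resE x kl) -eqz_mod_dvd -modz_nat modz_mod.
Qed.

(** Completeness of the p-adic integers: the residues of [f k] modulo p^k are compatible. *)
Lemma padic_limit (f : nat -> int) :
  (forall n, (Posz (p ^ n) %| f n.+1 - f n)%Z) -> exists x, forall k,
    pcong x k (f k).
Proof.
move=> fS; have pn0 n : Posz (p ^ n) != 0 by rewrite -lt0n expn_gt0 prime_gt0.
pose g n := `|(f n %% Posz (p ^ n))%Z|%N.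
have gE n : Posz (g n) = (f n %% Posz (p ^ n))%Z by rewrite gez0_abs //
  modz_ge0.
have gS n : g n.+1 = g n %[mod p ^ n].
  suff : (Posz (g n.+1) == g n %[mod Posz (p ^ n)])%Z.
    by rewrite !modz_nat eqz_nat => /eqP.
  rewrite !gE modz_mod -(eqP (_ : f n.+1 == f n %[mod Posz (p ^ n)])%Z).
    rewrite eqz_mod_dvd /modz addrAC subrr sub0r rpredN dvdz_mull //.
    by rewrite dvdzE /= dvdn_exp2l.
  by rewrite eqz_mod_dvd.
exists (padic_mk pp gS) => k.
by rewrite /pcong /= -eqz_mod_dvd -modz_nat modz_mod gE modz_mod.
Qed.

(** Newton iteration with a fixed slope: [c] inverts the derivative at [x0] modulo p and is never
    updated, so each step gains one factor p. *)
Lemma hensel_quadratic (be ga x0 : int) :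
  (p %| x0 ^+ 2 + be * x0 + ga)%Z -> ~~ (p %| 2 * x0 + be)%Z ->
  exists x : Zp, x * x + be%:~R * x + ga%:~R = 0.
Proof.
move=> rx0 rx1.
have [c cP] : exists c : int, (p %| 1 - c * (2 * x0 + be))%Z.
  have [u [v uv]] := Bezoutz p (2 * x0 + be).
  exists v.
  have g1 : gcdz p (2 * x0 + be) = 1.
    apply/eqP; rewrite -/(coprimez _ _) /coprimez /gcdz eqz_nat /=.
    by rewrite -/(coprime _ _) prime_coprime.
  by rewrite -[X in X - _]g1 -uv addrK dvdz_mull.
pose P (z : int) := z ^+ 2 + be * z + ga.
pose g (z : int) := z - c * P z.
pose f n := iter n g x0.
have fP n : (Posz p %| f n - x0)%Z && (Posz (p ^ n.+1) %| P (f n))%Z.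
  elim: n => [|n /andP[IH1 IH2]]; first by rewrite /= subrr dvdz0 expn1.
  have pPf : (p %| P (f n))%Z.
    by apply: dvdz_trans IH2; rewrite dvdzE /= expnS dvdn_mulr.
  apply/andP; split; rewrite [f n.+1]/= -/(f n).
    rewrite (_ : _ - _ = (f n - x0) - c * P (f n)); last by rewrite /g; ring.
    by rewrite rpredB // dvdz_mull.
  (* An exact factorisation of the new value. Each term of the cofactor is divisible by p: by the
     choice of [c], because the iterate stays congruent to [x0], and because p divides the old
     value. *)
  rewrite (_ : P (g (f n)) = P (f n) * ((1 - c * (2 * x0 + be))
      - c * 2 * (f n - x0) + c * c * P (f n))); last by rewrite /g /P; ring.
  rewrite expnSr PoszM dvdz_mul // rpredD ?dvdz_mull // rpredB // dvdz_mull //.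
have [x xf] : exists x : Zp, forall k, pcong x k (f k).
  apply: padic_limit => n; rewrite [f n.+1]/= -/(f n) /g addrAC subrr add0r.
  have /andP[_ fn] := fP n; rewrite rpredN dvdz_mull //.
  by apply: dvdz_trans fn; rewrite dvdzE /= dvdn_exp2l.
exists x; apply: pcong_eq0 => k.
have xP : pcong (x * x + be%:~R * x + ga%:~R) k (f k * f k + be * f k + ga).
  by rewrite !(pcongD, pcongM, pcong_int, xf).
apply: pcong_trans xP _; rewrite subr0 -expr2 -/(P (f k)).
have /andP[_ fn] := fP k.
by apply: dvdz_trans fn; rewrite dvdzE /= dvdn_exp2l.
Qed.

End PadicCongruence.

(** * Squares and sums of two squares modulo a prime *)

Section PrimeField.
Local Open Scope ring_scope.
Variables (p : nat) (pp : prime p).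
Implicit Types x y z c : int.

Lemma dvdp_Fp z : (p %| z)%Z = (z%:~R == 0 :> 'F_p).
Proof. exact: (dvdz_pcharf (pchar_Fp pp)). Qed.

Lemma Fp_int (u : 'F_p) : exists z, u = z%:~R.
Proof. by exists (u : nat); rewrite -[LHS]natr_Zp. Qed.

Lemma Fp_fermat (u : 'F_p) : u != 0 -> u ^+ p.-1 = 1.
Proof.
move=> u0; apply: (mulfI u0); rewrite mulr1 -exprS prednK ?prime_gt0 //.
by rewrite -[p in _ ^+ p](card_Fp pp) expf_card.
Qed.

(** A polynomial of degree (p - 1) / 2 cannot vanish at all p - 1 nonzero residues, so some [g]
    satisfies g^((p - 1) / 2) = -1, and g^((p - 1) / 4) is the root sought. *)
Lemma sqrt_minus1_mod : p = 1 %[mod 4] -> exists x, (p %| x ^+ 2 + 1)%Z.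
Proof.
move=> p1; have p_gt1 := prime_gt1 pp.
have [h hp] : exists h, p.-1 = (h * 4)%N.
  by exists (p %/ 4)%N; rewrite {1}(divn_eq p 4) p1 addn1.
have h0 : (0 < h)%N by case: h hp => //; lia.
suff [g [g0 gN]] : exists g : 'F_p, g != 0 /\ g ^+ (h * 2) != 1.
  have [x xg] := Fp_int (g ^+ h); exists x.
  rewrite dvdp_Fp rmorphD rmorphXn /= -xg -exprM.
  have /eqP := Fp_fermat g0; rewrite hp.
  have -> : (h * 4 = h * 2 * 2)%N by rewrite -mulnA.
  rewrite exprM.
  by rewrite sqrf_eq1 (negPf gN) => /eqP->; rewrite rmorph1 addNr.
apply: contrapT => H.
have Hg (g : 'F_p) : g != 0 -> g ^+ (h * 2) = 1.
  by move=> g0; apply/eqP; apply: contrapT => /negP gN; apply: H; exists g.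
have q0 : 'X^(h * 2) - 1 != 0 :> {poly 'F_p}.
  by rewrite -size_poly_eq0 size_Xn_sub_1 // muln_gt0 h0.
have := @max_poly_roots _ _ (enum (predC1 (0 : 'F_p))) q0.
rewrite -cardE cardC1 card_Fp // size_Xn_sub_1 ?muln_gt0 ?h0 // hp.
move=> /(_ _ (enum_uniq _)) Hs; suff : (h * 4 < (h * 2).+1)%N by lia.
apply: Hs; apply/allP => g; rewrite mem_enum inE => g0.
by rewrite /root !hornerE Hg // subrr.
Qed.

Hypothesis p_odd : odd p.

(** Pigeonhole: the (p + 1) / 2 squares and the (p + 1) / 2 values c - square cannot be disjoint
    among p residues. The clause on [x] is what Hensel lifting of [x] requires. *)
Lemma sum_two_squares_mod c : ~~ (p %| c)%Z ->
  exists x y, (p %| x ^+ 2 + y ^+ 2 - c)%Z && ~~ (p %| x)%Z.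
Proof.
move=> pc.
suff [u [v uv]] : exists u v : 'F_p, u ^+ 2 + v ^+ 2 = c%:~R.
  have [x xu] := Fp_int u; have [y yv] := Fp_int v.
  have pxy : (p %| x ^+ 2 + y ^+ 2 - c)%Z.
    by rewrite dvdp_Fp rmorphB rmorphD !rmorphXn /= -xu -yv uv subrr.
  have [px|npx] := boolP (p %| x)%Z; last by exists x, y; rewrite pxy.
  (* The two are exchanged when p divides [x]: p cannot divide both without dividing [c]. *)
  exists y, x; rewrite [y ^+ 2 + _]addrC pxy /=; apply: contra pc => py.
  have -> : c = x ^+ 2 + y ^+ 2 - (x ^+ 2 + y ^+ 2 - c) by ring.
  by rewrite rpredB // rpredD // expr2 dvdz_mull.
pose k := (p.+1)./2.
have kp : (k + k = p.+1)%N by rewrite addnn -[RHS]odd_double_half /= p_odd.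
pose f (i : 'I_k) : 'F_p := (i%:R) ^+ 2.
have f_inj : injective f.
  move=> i j /eqP; rewrite /f eqf_sqr => /orP[] /eqP.
    move=> /(congr1 (@nat_of_ord _)); rewrite !val_Fp_nat // !modn_small.
    - exact: val_inj.
    - by have := ltn_ord j; lia.
    - by have := ltn_ord i; lia.
  move=> /eqP; rewrite -addr_eq0 -natrD -(dvdn_pcharf (pchar_Fp pp)) => pij.
  have ij0 : (i + j = 0)%N.
    apply/eqP; rewrite -leqn0 leqNgt; apply/negP => /dvdn_leq/(_ pij).
    by have := ltn_ord i; have := ltn_ord j; have := prime_gt1 pp; lia.
  move/eqP: ij0; rewrite addn_eq0 => /andP[/eqP i0 /eqP j0].
  by apply: ord_inj; rewrite i0 j0.
pose g i : 'F_p := c%:~R - f i.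
have g_inj : injective g by move=> i j /addrI/oppr_inj/f_inj.
have [i [j fg]] : exists i j, f i = g j.
  apply: contrapT => fg; pose h (s : 'I_k + 'I_k) :=
    match s with inl i => f i | inr j => g j end.
  have h_inj : injective h.
    move=> [i|i] [j|j] /= ij; first by rewrite (f_inj _ _ ij).
    - by case: fg; exists i, j.
    - by case: fg; exists j, i.
    - by rewrite (g_inj _ _ ij).
  by have := leq_card h h_inj; rewrite card_sum !card_ord Fp_cast // kp ltnn.
exists (i%:R), (j%:R).
by rewrite -/(f i) -/(f j) fg /g subrK.
Qed.

(** With v nonzero, raising u^2 = - v^2 to the odd power (p - 1) / 2 gives 1 = -1 by Fermat. *)
Lemma sum_squares_dvd x y : p = 3 %[mod 4] ->
  (p %| x ^+ 2 + y ^+ 2)%Z -> (p %| x)%Z && (p %| y)%Z.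
Proof.
move=> p3; have [h hp] : exists h, p.-1 = (2 * h.*2.+1)%N.
  by exists (p %/ 4)%N; rewrite {1}(divn_eq p 4) p3; lia.
have two0 : (2%:R : 'F_p) != 0.
  by rewrite -(dvdn_pcharf (pchar_Fp pp)) dvdn_prime2 //;
    apply: contraL p_odd => /eqP->.
rewrite !dvdp_Fp rmorphD !rmorphXn /=;
  move: (x%:~R : 'F_p) (y%:~R : 'F_p) => u v uv.
suff v0 : v == 0 by move: uv;
  rewrite (eqP v0) expr0n addr0 expf_eq0 /= eqxx andbT.
apply: contraT => v0; have u0 : u != 0.
  by apply: contra v0 => /eqP u0; move: uv; rewrite u0 expr0n add0r expf_eq0.
have u2 : u ^+ 2 = - v ^+ 2 by apply/eqP; rewrite -addr_eq0.
have := Fp_fermat u0; rewrite hp exprM u2 exprNn -exprM -hp Fp_fermat //.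
rewrite mulr1 -signr_odd /= odd_double /= => /eqP.
by rewrite expr1 -subr_eq0 -opprD oppr_eq0 (negPf two0).
Qed.

End PrimeField.

(** * Local ramification of (-1, c) *)

Lemma fraction_denom (R : idomainType) (x : {fraction R}) :
  exists d n : R, (d != 0 /\ x * FracField.tofrac d = FracField.tofrac n)%R.
Proof.
elim/quotW: x => r; exists r.2, r.1; split; first exact: denom_ratioP.
unlock FracField.tofrac; rewrite -[LHS]FracField.pi_mul; apply/eqmodP.
rewrite /= FracField.equivfE /FracField.mulf !numden_Ratio ?oner_eq0 ?mulr1 //.
- by rewrite mulrC.
- by rewrite ?mulr1 denom_ratioP.
- by rewrite ?mulr1 denom_ratioP.
Qed.

Section LocalRamification.
Local Open Scope ring_scope.

(** The quaternion x + y i + z j has norm x^2 + y^2 - c z^2, so it is an isotropic vector. *)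
Lemma sum_squares_not_division (F : fieldType) (c x y z : F) :
  x ^+ 2 + y ^+ 2 = c * z ^+ 2 -> (y != 0) || (z != 0) ->
  ~ division_algebra (quat (-1) c).
Proof.
move=> xyz yz /division_quatP /(_ (mkq (-1) c x y z 0)) H.
have /H/quatP[_] : nrd (mkq (-1) c x y z 0) = 0.
  rewrite /nrd !mkqE; apply: (@eq_trans _ _ (x ^+ 2 + y ^+ 2 - c * z ^+ 2)).
    by ring.
  by rewrite xyz subrr.
by rewrite !qE => y0 z0; rewrite y0 z0 eqxx in yz.
Qed.

Variables (p : nat) (pp : prime p).
Local Notation Zp := (padic_int pp).
Local Notation Qp := (padic pp).
Local Notation tofrac := (@FracField.tofrac Zp).

(** Since n + 1 < p^(n + 1), the integer n + 1 is nonzero modulo p^(n + 1). *)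
Lemma padic_int_char0 n : (n.+1%:R : Zp) != 0.
Proof.
apply/eqP => n0; have := pcong_nat pp n.+1 n.+1; rewrite n0 pcong0 dvdzE /=.
by move=> /dvdn_leq -/(_ isT); rewrite leqNgt ltn_expl ?prime_gt1.
Qed.

Lemma padic_char0 n : (n.+1%:R : Qp) != 0.
Proof. by rewrite -(rmorph_nat tofrac) tofrac_eq0 padic_int_char0. Qed.

Lemma int_sum_squares_not_division (c : int) (x y z : Zp) :
  x ^+ 2 + y ^+ 2 = c%:~R * z ^+ 2 -> (y != 0) || (z != 0) ->
  ~ division_algebra (quat (-1) (c%:~R : Qp)).
Proof.
move=> xyz yz; apply: (@sum_squares_not_division _ _ (tofrac x) (tofrac y)
  (tofrac z)).
  by rewrite -(rmorph_int tofrac) -!rmorphXn -rmorphD -rmorphM xyz.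
by rewrite !tofrac_eq0.
Qed.

(** Solve x^2 + y^2 = c modulo p with p not dividing x, then lift x while y stays fixed. *)
Lemma unit_not_division (c : int) : odd p -> ~~ (p %| c)%Z ->
  ~ division_algebra (quat (-1) (c%:~R : Qp)).
Proof.
move=> p_odd pc; have [x0 [y /andP[pxy px0]]] :=
  sum_two_squares_mod pp p_odd pc.
have [x xE] : exists x : Zp, x * x + 0%:~R * x + (y ^+ 2 - c)%:~R = 0.
  apply: (@hensel_quadratic _ _ _ _ x0); first by rewrite mul0r addr0 addrA.
  rewrite addr0; apply: contra px0.
  rewrite Gauss_dvdzr // coprimezE /= coprime_sym prime_coprime //.
  by rewrite dvdn2 p_odd.
apply: (@int_sum_squares_not_division _ x y%:~R 1);
  last by rewrite oner_eq0 orbT.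
apply/eqP; rewrite -subr_eq0 -[X in _ == X]xE; apply/eqP.
by rewrite rmorphB rmorphXn /=; ring.
Qed.

(** A p-adic square root of -1 gives an isotropic vector with z = 0, whatever [c] is. *)
Lemma sqrt_not_division (c : int) : p = 1 %[mod 4] ->
  ~ division_algebra (quat (-1) (c%:~R : Qp)).
Proof.
move=> p1; have p_odd : odd p by have := divn_eq p 4; rewrite p1; lia.
have [x0 px0] := sqrt_minus1_mod pp p1.
have [x xE] : exists x : Zp, x * x + 0%:~R * x + 1%:~R = 0.
  apply: (@hensel_quadratic _ _ _ _ x0); first by rewrite mul0r addr0.
  rewrite addr0; apply/negP => px.
  have {}px : (p %| x0)%Z.
    move: px; rewrite Gauss_dvdzr // coprimezE /= coprime_sym prime_coprime //.
    by rewrite dvdn2 p_odd.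
  have : (p %| 1)%Z.
    have -> : 1 = (x0 ^+ 2 + 1) - x0 * x0 :> int by ring.
    by rewrite rpredB // dvdz_mull.
  by rewrite dvdzE /= dvdn1 => /eqP p_eq1; have := prime_gt1 pp; rewrite p_eq1.
apply: (@int_sum_squares_not_division _ x 1 0); last by rewrite oner_eq0.
by rewrite expr0n mulr0 -xE; ring.
Qed.

(** Write c = y^2 + (1 + 8 k) with y = 0 or 2 according to c modulo 8. Then 1 + 8 k = (1 + 2 w)^2 as
    soon as w^2 + w = 2 k, an equation whose derivative is odd. *)
Lemma dyadic_not_division (c : int) : p = 2%N -> (4 %| c - 1)%Z ->
  ~ division_algebra (quat (-1) (c%:~R : Qp)).
Proof.
move=> p2 /dvdzP[n cn].
have [y [k yk]] : exists y k : int, c = y ^+ 2 + 1 + 4 * (2 * k).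
  have [[k nk]|[k nk]] : (exists k, n = 2 * k) \/ (exists k, n = 2 * k + 1).
    case: (boolP (2 %| n)%Z) => [/dvdzP[k nk]|n2]; [left|right].
      by exists k; rewrite nk mulrC.
    by exists (n %/ 2)%Z; lia.
  - by exists 0, k; rewrite -[c](subrK 1) cn nk; ring.
  - by exists 2, k; rewrite -[c](subrK 1) cn nk; ring.
have [w wE] : exists w : Zp, w * w + 1%:~R * w + (- (2 * k))%:~R = 0.
  apply: (@hensel_quadratic _ _ _ _ 0); last by rewrite p2 mulr0 add0r.
  by rewrite p2 expr0n mulr0 !add0r rpredN dvdz_mulr.
apply: (@int_sum_squares_not_division _ (1 + 2%:R * w) y%:~R 1).
  2: by rewrite oner_eq0 orbT.
rewrite yk expr1n mulr1; apply/eqP; rewrite -subr_eq0; apply/eqP.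
rewrite -[RHS](mulr0 4%:R) -[in RHS]wE !(rmorphD, rmorphN, rmorphM,
  rmorphXn) /=.
by ring.
Qed.

(** Moves ramification of (-1, -m) to integer arithmetic. The hypothesis is a quantitative
    anisotropy: a p-adically small norm forces small coordinates. *)
Lemma division_padic (m : int) :
  (forall k, exists K, forall x0 x1 x2 x3 : int,
     (Posz (p ^ K) %| x0 ^+ 2 + x1 ^+ 2 + m * (x2 ^+ 2 + x3 ^+ 2))%Z ->
     [&& (Posz (p ^ k) %| x0)%Z, (Posz (p ^ k) %| x1)%Z, (Posz (p ^ k) %| x2)%Z
       & (Posz (p ^ k) %| x3)%Z]) ->
  division_algebra (quat (-1) ((- m)%:~R : Qp)).
Proof.
move=> H.
have HZ (x0 x1 x2 x3 : Zp) :
    x0 ^+ 2 + x1 ^+ 2 + m%:~R * (x2 ^+ 2 + x3 ^+ 2) = 0 ->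
    [/\ x0 = 0, x1 = 0, x2 = 0 & x3 = 0].
  move=> S0.
  have Hk k : [&& pcong x0 k 0, pcong x1 k 0, pcong x2 k 0 & pcong x3 k 0].
    have [K HK] := H k.
    have := HK (x0 (maxn k K)) (x1 (maxn k K)) (x2 (maxn k K)) (x3 (maxn k K)).
    have : pcong (x0 ^+ 2 + x1 ^+ 2 + m%:~R * (x2 ^+ 2 + x3 ^+ 2)) (maxn k K)
      (Posz (x0 (maxn k K)) ^+ 2 + Posz (x1 (maxn k K)) ^+ 2
        + m * (Posz (x2 (maxn k K)) ^+ 2 + Posz (x3 (maxn k K)) ^+ 2)).
      by rewrite !expr2 !(pcongD, pcongM, pcong_int, pcong_refl).
    rewrite S0 pcong0 => Kdvd -/(_ _)/and4P[].
      by apply: dvdz_trans Kdvd; rewrite dvdzE /= dvdn_exp2l // leq_maxr.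
    have kk (x : Zp) : (Posz (p ^ k) %| Posz (x (maxn k K)))%Z -> pcong x k 0.
      move=> kx; apply: pcong_trans (pcong_res _ (leq_maxl k K)) _.
      by rewrite subr0.
    by do 4!move=> /kk ->.
  by split; apply: pcong_eq0 => k; case/and4P: (Hk k).
apply/division_quatP => q.
have [d0 [n0 [d0N q0]]] := fraction_denom (qc 0 q).
have [d1 [n1 [d1N q1]]] := fraction_denom (qc 1 q).
have [d2 [n2 [d2N q2]]] := fraction_denom (qc 2 q).
have [d3 [n3 [d3N q3]]] := fraction_denom (qc 3 q).
(* Scaling by a common denominator keeps the norm zero and moves all coordinates into the p-adic
   integers. *)
pose d := d0 * d1 * d2 * d3; have dN : tofrac d != 0.
  by rewrite tofrac_eq0 !mulf_neq0.
rewrite /nrd => nq.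
have [] := HZ (n0 * d1 * d2 * d3) (n1 * d0 * d2 * d3) (n2 * d0 * d1 * d3)
    (n3 * d0 * d1 * d2).
  apply/eqP; rewrite -tofrac_eq0 !(rmorphD, rmorphM, rmorphXn, rmorph_int) /=.
  rewrite -q0 -q1 -q2 -q3.
  apply/eqP; rewrite -[RHS](mulr0 (tofrac d ^+ 2)) -{}nq !rmorphM /= rmorphN /=.
  by ring.
have scaled (x : Qp) (e n u : Zp) : x * tofrac e = tofrac n ->
    e * u = d -> n * u = 0 -> x = 0.
  move=> xe eu nu; apply: (mulIf dN).
  by rewrite mul0r -eu tofracM mulrA xe -tofracM nu tofrac0.
move=> e0 e1 e2 e3; apply/quatP; rewrite !qE; split.
- by apply: (scaled _ _ _ (d1 * d2 * d3) q0); rewrite -?e0 /d; ring.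
- by apply: (scaled _ _ _ (d0 * d2 * d3) q1); rewrite -?e1 /d; ring.
- by apply: (scaled _ _ _ (d0 * d1 * d3) q2); rewrite -?e2 /d; ring.
- by apply: (scaled _ _ _ (d0 * d1 * d2) q3); rewrite -?e3 /d; ring.
Qed.

(** Descent: modulo p only x0^2 + x1^2 remains, so p divides x0 and x1; after division by p the same
    argument applies to x2 and x3. Each round costs a factor p^2, hence [K.+2]. *)
Lemma odd_division (m : int) : p = 3 %[mod 4] -> ~~ (p %| m)%Z ->
  division_algebra (quat (-1) ((- (Posz p * m))%:~R : Qp)).
Proof.
move=> p3 pm; have p_odd : odd p by have := divn_eq p 4; rewrite p3; lia.
apply: division_padic; elim=> [|k [K IHk]].
  by exists 0%N => *; rewrite expn0 !dvd1z.
exists K.+2 => x0 x1 x2 x3 HK.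
have p0 : Posz p != 0 by rewrite -lt0n prime_gt0.
have pK : Posz (p ^ K.+2) = Posz p * (Posz p * Posz (p ^ K)).
  by rewrite !expnS !PoszM.
rewrite {}pK in HK.
have [r Sr] := dvdzP HK.
have /andP[/dvdzP[y0 x0E] /dvdzP[y1 x1E]] : (p %| x0)%Z && (p %| x1)%Z.
  apply: sum_squares_dvd => //; apply/dvdzP.
  exists (r * (Posz p * Posz (p ^ K)) - m * (x2 ^+ 2 + x3 ^+ 2)).
  by apply/eqP; rewrite -(inj_eq (addIr (Posz p * m * (x2 ^+ 2 + x3 ^+ 2)))) Sr;
    apply/eqP; ring.
have /andP[/dvdzP[y2 x2E] /dvdzP[y3 x3E]] : (p %| x2)%Z && (p %| x3)%Z.
  apply: sum_squares_dvd => //.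
  have : (p %| m * (x2 ^+ 2 + x3 ^+ 2))%Z.
    apply/dvdzP; exists (r * Posz (p ^ K) - (y0 ^+ 2 + y1 ^+ 2)).
    apply: (mulfI p0); apply/eqP.
    rewrite -(inj_eq (addrI (x0 ^+ 2 + x1 ^+ 2))) mulrA Sr x0E x1E.
    by apply/eqP; ring.
  by rewrite Gauss_dvdzr // coprimezE /= prime_coprime.
have : (Posz (p ^ K) %| y0 ^+ 2 + y1 ^+ 2 + Posz p * m * (y2 ^+ 2 + y3 ^+ 2))%Z.
  apply/dvdzP; exists r; apply: (mulfI p0); apply: (mulfI p0).
  rewrite [RHS](_ : _ = r * (Posz p * (Posz p * Posz (p ^ K)))); last by ring.
  by rewrite -Sr x0E x1E x2E x3E; ring.
move=> /IHk/and4P[y0k y1k y2k y3k].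
by rewrite x0E x1E x2E x3E expnSr PoszM !dvdz_mul.
Qed.

(** An odd square is 1 modulo 8 and an even one is a multiple of 4. Modulus 4 would be too weak:
    four odd coordinates give the value 4 modulo 8. *)
Lemma even_sum_squares (m x0 x1 x2 x3 : int) : (4 %| m - 1)%Z ->
  (8 %| x0 ^+ 2 + x1 ^+ 2 + m * (x2 ^+ 2 + x3 ^+ 2))%Z ->
  [&& (2 %| x0)%Z, (2 %| x1)%Z, (2 %| x2)%Z & (2 %| x3)%Z].
Proof.
have sq8 (x : int) : (exists y, x = 2 * y) /\ (exists a, x ^+ 2 = 4 * a)
    \/ (exists a, x ^+ 2 = 8 * a + 1).
  case: (boolP (2 %| x)%Z) => [/dvdzP[y ->]|xodd]; [left|right].
    by split; [exists y; ring | exists (y ^+ 2); ring].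
  have [y ->] : exists y, x = 2 * y + 1 by exists (x %/ 2)%Z; lia.
  have [a ya] : exists a, y * (y + 1) = 2 * a.
    have [[z ->]|[z ->]] : (exists z, y = 2 * z) \/ (exists z, y = 2 * z + 1).
    - case: (boolP (2 %| y)%Z) => ypar; [left|right];
        by exists (y %/ 2)%Z; lia.
    - by exists (z * (2 * z + 1)); ring.
    - by exists ((2 * z + 1) * (z + 1)); ring.
  exists a; have -> : (2 * y + 1) ^+ 2 = 4 * (y * (y + 1)) + 1 by ring.
  by rewrite ya; ring.
move=> /dvdzP[n mn] /dvdzP[r Sr]; have {mn} mE : m = 4 * n + 1 by lia.
have dvd2 (x y : int) : x = 2 * y -> (2 %| x)%Z.
  by move=> ->; rewrite dvdz_mulr.
move: Sr; rewrite mE.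
have [[[y0 /dvd2->] [a0 ->]]|[a0 ->]] := sq8 x0;
have [[[y1 /dvd2->] [a1 ->]]|[a1 ->]] := sq8 x1;
have [[[y2 /dvd2->] [a2 ->]]|[a2 ->]] := sq8 x2;
have [[[y3 /dvd2->] [a3 ->]]|[a3 ->]] := sq8 x3 => //; clear; lia.
Qed.

(** Halving the coordinates divides the form by 4, so 2 k + 1 bits of precision are enough: each
    round uses two, and at least three are there whenever a halving is needed. *)
Lemma dyadic_division (m : int) : p = 2%N -> (4 %| m - 1)%Z ->
  division_algebra (quat (-1) ((- m)%:~R : Qp)).
Proof.
move=> p2 m1; apply: division_padic => k; exists (k.*2.+1).
rewrite p2; elim: k => [|k IHk] x0 x1 x2 x3 HK.
  by rewrite expn0 !dvd1z.
have KE : Posz (2 ^ k.+1.*2.+1) = 4 * Posz (2 ^ k.*2.+1).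
  by rewrite doubleS !expnS !PoszM; ring.
have K8 : (8 %| Posz (2 ^ k.+1.*2.+1))%Z.
  by rewrite doubleS !expnS dvdzE /= !mulnA dvdn_mulr.
have /and4P[/dvdzP[y0 x0E] /dvdzP[y1 x1E] /dvdzP[y2 x2E] /dvdzP[y3 x3E]] :=
  even_sum_squares m1 (dvdz_trans K8 HK).
have : (Posz (2 ^ k.*2.+1) %| y0 ^+ 2 + y1 ^+ 2 + m * (y2 ^+ 2 + y3 ^+ 2))%Z.
  rewrite -(@dvdz_mul2l 4%R) -?KE //.
  by move: HK; rewrite x0E x1E x2E x3E; apply: etrans; congr (_ %| _)%Z; ring.
move=> /IHk/and4P[y0k y1k y2k y3k].
by rewrite x0E x1E x2E x3E expnSr PoszM !dvdz_mul.
Qed.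

End LocalRamification.

(** * Ramification and definiteness read off an anticommuting pair *)

Section Transport.
Local Open Scope ring_scope.
Variables (a b : rat) (c : int) (W1 W2 : quat a b).
Hypotheses (c0 : c != 0) (W11 : W1 * W1 = -1) (W22 : W2 * W2 = c%:~R%:A).
Hypothesis W21 : W2 * W1 = - (W1 * W2).

(** The pair presents the algebra as (-1, c) already over the rationals, hence over [K]. Taking for
    [K] a p-adic field or the reals turns local behaviour into a condition on [c]. *)
Lemma division_ratr (K : fieldType) : (forall n, (n.+1%:R : K) != 0) ->
  division_algebra (quat (ratr a : K) (ratr b)) <->
  division_algebra (quat (-1) (c%:~R : K)).
Proof.
move=> K0; have [f fE] := ratr_rmorph K0; rewrite -!fE.
rewrite -(rmorph_int f c) -(rmorph1 f) -rmorphN.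
apply: (@division_qmap _ _ _ _ _ _ _ W1 W2) => //.
- by rewrite intr_eq0.
- by rewrite W11 scaleNr scale1r.
Qed.

Lemma ramified_atP p : ramified_at a b p <->
  exists pp : prime p, division_algebra (quat (-1) (c%:~R : padic pp)).
Proof.
have H (pp : prime p) := @division_ratr (padic pp) (padic_char0 pp).
by split=> -[pp dp]; exists pp; case: (H pp) => H1 H2; [exact: H1|exact: H2].
Qed.

(** For c > 0 the real quaternion sqrt(c) + j is isotropic. *)
Lemma definite_lt0 : definite a b -> c < 0.
Proof.
have R0 n : (n.+1%:R : Rdefinitions.R) != 0 by rewrite pnatr_eq0.
move=> /(proj1 (division_ratr R0)) dR.
rewrite ltNge le_eqVlt eq_sym (negPf c0) /=; apply/negP => c_gt0.
apply: (@sum_squares_not_division Rdefinitions.R c%:~R (Num.sqrt c%:~R) 0 1) dR.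
  by rewrite sqr_sqrtr ?ler0z ?ltW // expr0n addr0 expr1n mulr1.
by rewrite oner_eq0 orbT.
Qed.

Lemma lt0_definite : c < 0 -> definite a b.
Proof.
move=> c_lt0; have R0 n : (n.+1%:R : Rdefinitions.R) != 0 by rewrite pnatr_eq0.
apply: (proj2 (division_ratr R0)).
apply/division_quatP => x; rewrite /nrd => nx.
have cR : (c%:~R : Rdefinitions.R) < 0 by rewrite ltrz0.
have : qc 0 x ^+ 2 + qc 1 x ^+ 2 + (- c%:~R) * (qc 2 x ^+ 2 + qc 3 x ^+ 2) == 0.
  by rewrite -[X in _ == X]nx; apply/eqP; ring.
have sq (y z : Rdefinitions.R) : 0 <= y ^+ 2 + z ^+ 2 by rewrite addr_ge0
  ?sqr_ge0.
have sq0 (y z : Rdefinitions.R) : y ^+ 2 + z ^+ 2 == 0 -> y = 0 /\ z = 0.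
  rewrite paddr_eq0 ?sqr_ge0 // !sqrf_eq0 => /andP[/eqP-> /eqP->].
  by [].
have cN : 0 <= - (c%:~R : Rdefinitions.R) by rewrite oppr_ge0 ltW.
rewrite paddr_eq0 ?sq ?mulr_ge0 ?sq // mulf_eq0 oppr_eq0 (lt_eqF cR) /=.
by move=> /andP[/sq0[e0 e1] /sq0[e2 e3]]; apply/quatP; rewrite !qE.
Qed.

End Transport.

(** * Orders in quaternion algebras over the rationals *)

Section TraceNorm.
Local Open Scope ring_scope.
Variables (F : fieldType) (a b : F).
Implicit Types x y : quat a b.

Lemma trdD x y : trd (x + y) = trd x + trd y.
Proof. by rewrite /trd !qE; ring. Qed.

Lemma trdZ (c : F) x : trd (c *: x) = c * trd x.
Proof. by rewrite /trd !qE; ring. Qed.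

Lemma trdN x : trd (- x) = - trd x.
Proof. by rewrite /trd !qE; ring. Qed.

Lemma trd1 : trd (1 : quat a b) = 2%:R.
Proof. by rewrite /trd !qE. Qed.

Lemma trdC x y : trd (x * y) = trd (y * x).
Proof. by rewrite /trd !qE; ring. Qed.

(** The products x (y x) and (y x) x have the same trace, but they are - al y and al y. *)
Lemma trd_anticomm (al : F) x y : 2%:R != 0 :> F -> al != 0 ->
  x * x = al%:A -> y * x = - (x * y) -> trd y = 0.
Proof.
move=> n2 al0 xx yx; apply/eqP.
have : (2%:R * al) * trd y == 0.
  have := trdC x (y * x); rewrite {1}yx mulrN mulrA xx -mulrA xx.
  rewrite -scaleN1r -scalerAl -scalerAr mul1r mulr1 !trdZ => /eqP.
  by rewrite -subr_eq0 -oppr_eq0; apply: etrans; congr (_ == 0); ring.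
by rewrite !mulf_eq0 (negPf n2) (negPf al0).
Qed.

End TraceNorm.

Section OrderTheory.
Local Open Scope ring_scope.
Variables (a b : rat).
Local Notation A := (quat a b).
Implicit Types (O : set A) (x y : A).

(** Matrix form of a Z-basis, so that multiplication by an element of an order becomes conjugate to
    an integer matrix. *)
Definition lattice (E : 'M[rat]_4) x : Prop :=
  exists z : 'rV[int]_4, x = map_mx intr z *m E.

Lemma dim_quat : \dim {:A} = 4.
Proof. by rewrite dimvf. Qed.

Lemma order_lattice O : is_order O ->
  exists2 E, E \in unitmx & forall x, O x <-> lattice E x.
Proof.
(* The dimension must become 4 in the type of the tuple [e] itself. *)
case=> _ _ _ [e]; move: (\dim {:A}) dim_quat e => n -> {n} e.
rewrite /basis_of => /andP[_ /freeP fe] OE.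
exists (\matrix_(i, j) (e`_i : A) 0 j).
  rewrite -row_free_unit; apply: inj_row_free => v ve.
  apply/rowP => i; rewrite mxE; apply: (fe (fun i => v 0 i)).
  apply: etrans ve; rewrite mulmx_sum_row; apply: eq_bigr => j _;
    congr (_ *: _).
  by apply/rowP => k; rewrite !mxE.
have sumE (z : 'I_4 -> int) : \sum_(i < 4) e`_i *~ z i
   = map_mx intr (\row_i z i) *m (\matrix_(i, j) (e`_i : A) 0 j) :> A.
  rewrite mulmx_sum_row; apply: eq_bigr => i _; rewrite !mxE -scaler_int.
  by congr (_ *: _); apply/rowP => k; rewrite !mxE.
move=> x; rewrite OE; split=> [[z ->]|[z ->]].
  by exists (\row_i z i); rewrite sumE.
exists (fun i => z 0 i); rewrite sumE; congr (map_mx _ _ *m _).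
by apply/rowP => i; rewrite mxE.
Qed.

Lemma lattice_order O E : E \in unitmx -> (forall x, O x <-> lattice E x) ->
  O 1 -> (forall x y, O x -> O y -> O (x * y)) -> is_order O.
Proof.
move=> uE OE O1 OM; split=> //.
  move=> x y /OE[z ->] /OE[t ->]; apply/OE; exists (z - t).
  by rewrite map_mxB mulmxBl.
pose e0 : 4.-tuple A := [tuple row i E | i < 4].
have e0E (i : 'I_4) : e0`_i = row i E by rewrite /e0 -tnth_nth tnth_mktuple.
have be : basis_of {:A} e0.
  rewrite basisEfree size_tuple dim_quat leqnn subvf andbT andbT.
  apply/freeP => k; rewrite (eq_bigr (fun i => k i *: row i E)) => [|i _];
    last by rewrite e0E.
  have -> : \sum_i k i *: row i E = (\row_i k i) *m E.
    by rewrite mulmx_sum_row; apply: eq_bigr => i _; rewrite mxE.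
  move=> kE i; have : (\row_i k i) *m E *m invmx E = 0 by rewrite kE mul0mx.
  by rewrite mulmxK // => /rowP/(_ i); rewrite !mxE.
have sumE (z : 'I_4 -> int) : \sum_(i < 4) e0`_i *~ z i
   = map_mx intr (\row_i z i) *m E :> A.
  rewrite mulmx_sum_row; apply: eq_bigr => i _.
  by rewrite !mxE -scaler_int e0E.
have OS : O = [set x | exists z : 'I_4 -> int,
  x = \sum_(i < 4) e0`_i *~ z i]%classic.
  apply/funext => x; apply/propext; rewrite OE; split=> [[z ->]|[z ->]].
    exists (fun i => z 0 i); rewrite sumE; congr (map_mx _ _ *m _).
    by apply/rowP => i; rewrite mxE.
  by exists (\row_i z i); rewrite sumE.
move: e0 be {e0E sumE} OS; rewrite -[4%N]dim_quat => e0 be OS.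
by exists e0.
Qed.

(** Multiplying the first basis vector by r stays in [O], and the first coordinate of the result is
    r. *)
Lemma order_scalar O (r : rat) : is_order O -> O r%:A -> exists z : int,
  r = z%:~R.
Proof.
move=> oO Or; have [E uE OE] := order_lattice oO; have [_ _ OM _] := oO.
have Oe : O (row 0 E).
  by apply/OE; exists (delta_mx 0 0); rewrite map_delta_mx rowE.
have := OM _ _ Or Oe; rewrite -scalerAl mul1r => /OE[z /(congr1 (mulmx^~ (invmx
  E)))].
rewrite mulmxK // -scalemxAl rowE mulmxK // => /rowP/(_ 0).
by rewrite !mxE !eqxx mulr1 => ->; exists (z 0 0).
Qed.

(** Left multiplication by [x] has trace 2 trd(x) in the standard basis and an integer matrix in a
    basis of [O]. *)
Lemma order_trd2 O x : is_order O -> O x -> exists z : int,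
  trd x + trd x = z%:~R.
Proof.
move=> oO Ox; have [E uE OE] := order_lattice oO; have [_ _ OM _] := oO.
pose L : 'M[rat]_4 := \matrix_(i, j) (x * (row i 1%:M : A)) 0 j.
have LE y : y *m L = x * y.
  rewrite mulmx_sum_row -[in RHS](mulmx1 y) [in RHS]mulmx_sum_row mulr_sumr.
  apply: eq_bigr => i _; rewrite -scalerAr; congr (_ *: _).
  by apply/rowP => j; rewrite !mxE.
have trL : \tr L = trd x + trd x.
  rewrite /mxtrace sum_ord4 ![L _ _]mxE -!/(qc _ _) !qcM.
  have cE k l : (k < 4)%N -> (l < 4)%N ->
      qc l (row (inord k) 1%:M : A) = (k == l)%:R.
    by move=> k4 l4; rewrite /qc !mxE -val_eqE /= !inordK.
  by rewrite !cE //= /trd; ring.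
have rowE1 i : O (row i E) by apply/OE; exists (delta_mx 0 i);
  rewrite map_delta_mx rowE.
have /fin_all_exists[z zE] i := (OE _).1 (OM _ _ Ox (rowE1 i)).
pose Z : 'M[int]_4 := \matrix_(i, j) z i 0 j.
have EL : E *m L = map_mx intr Z *m E.
  apply/row_matrixP => i; rewrite row_mul LE zE row_mul; congr (_ *m _).
  by apply/rowP => j; rewrite !mxE.
exists (\tr Z); rewrite -trL -[L](mulKmx uE) EL mxtrace_mulC mulmxK //.
by rewrite /mxtrace rmorph_sum; apply: eq_bigr => i _; rewrite mxE.
Qed.

Lemma order0 O : is_order O -> O 0.
Proof. by case=> O1 OB _ _; rewrite -(subrr 1); apply: OB. Qed.

Lemma orderN O x : is_order O -> O x -> O (- x).
Proof.
by move=> oO Ox; have [_ OB _ _] := oO; rewrite -sub0r;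
  apply: OB (order0 oO) Ox.
Qed.

Lemma orderD O x y : is_order O -> O x -> O y -> O (x + y).
Proof.
move=> oO Ox Oy; have [_ OB _ _] := oO.
by rewrite -[y]opprK; apply: OB Ox (orderN oO Oy).
Qed.

Lemma orderMz O x (z : int) : is_order O -> O x -> O (x *~ z).
Proof.
move=> oO Ox; have On (n : nat) : O (x *+ n).
  elim: n => [|n IHn]; first by rewrite mulr0n; apply: order0.
  by rewrite mulrS; apply: orderD.
case: z => n; first by rewrite -pmulrn.
by rewrite NegzE mulrNz -pmulrn; apply: orderN.
Qed.

Lemma orderZ O x (z : int) : is_order O -> O x -> O (z%:~R *: x).
Proof. by rewrite scaler_int; apply: orderMz. Qed.

Lemma order_int O (z : int) : is_order O -> O (z%:~R%:A).
Proof. by move=> oO; apply: orderZ; case: oO. Qed.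

(* Only twice the reduced trace is the trace of an integer matrix; the square
   x^2 = trd(x) x - nrd(x) gives the missing parity. *)
Lemma order_trd O x : is_order O -> O x -> exists z : int, trd x = z%:~R.
Proof.
move=> oO Ox; have [k kE] := order_trd2 oO Ox; have [_ OB OM _] := oO.
have [l lE] : exists l : int, nrd x + nrd x = l%:~R.
  apply: (order_scalar oO).
  have -> : (nrd x + nrd x)%:A = k%:~R *: x - (2 : int)%:~R *: (x * x) :> A.
    rewrite quat_sqr -kE; move: (1 : A) => o; apply/rowP => i; rewrite !mxE.
    by ring.
  by apply: OB; apply: orderZ => //; apply: OM.
have [h hE] := order_trd2 oO (OM _ _ Ox Ox).
have kk : k * k = 2 * (h + 2 * l).
  apply: (@intr_inj rat); rewrite !(rmorphM, rmorphD) /= -kE -lE -hE.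
  by rewrite quat_sqr /trd /nrd !qE; ring.
have /dvdzP[t kt] : (2 %| k)%Z.
  have : (2 %| k * k)%Z by rewrite kk dvdz_mulr.
  by rewrite !dvdzE /= abszM Euclid_dvdM // orbb.
exists t; apply: (@mulIf _ 2%:R) => //.
by rewrite mulr_natr mulr2n kE kt rmorphM.
Qed.

Lemma order_nrd O x : is_order O -> O x -> exists z : int, nrd x = z%:~R.
Proof.
move=> oO Ox; have [k kE] := order_trd oO Ox; have [_ OB OM _] := oO.
apply: (order_scalar oO).
have -> : (nrd x)%:A = k%:~R *: x - x * x by rewrite quat_sqr kE subKr.
by apply: OB; [apply: orderZ | apply: OM].
Qed.

(* O1 / O is a quotient of (Z / (c + 1))^4, and all fibres of the quotient map
   have the same size. *)
Lemma has_index_dvd O1 O N (c : nat) : is_order O1 ->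
  (forall x y, O x -> O y -> O (x - y)) -> has_index O1 O N ->
  (forall x, O1 x -> O (c.+1%:R *: x)) -> (N %| c.+1 ^ 4)%N.
Proof.
move=> oO1 OB [s [sN sO1 s_inj s_surj]] cO.
have [E uE O1E] := order_lattice oO1.
have O0 : O 0.
  have O1_1 : O1 1 by case: oO1.
  by rewrite -(subrr (c.+1%:R *: (1 : A))); apply: OB; apply: cO.
have ON x : O x -> O (- x) by move=> Ox; rewrite -sub0r; apply: OB.
have OD x y : O x -> O y -> O (x + y).
  by move=> Ox Oy; rewrite -[y]opprK; apply: OB => //; apply: ON.
pose V := 'rV['I_c.+1]_4.
(* [lift] uses the representatives 0, ..., c and is not additive; the carries are multiples of c + 1
   and vanish modulo [O] ([liftD]). *)
pose lift (z : V) : A := map_mx (fun i : 'I_c.+1 => (i : nat)%:R) z *m E.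
have liftO1 z : O1 (lift z).
  apply/O1E; exists (map_mx (fun i : 'I_c.+1 => Posz i) z).
  by rewrite /lift -map_mx_comp; congr (_ *m _); apply/rowP => i; rewrite !mxE.
have lift_mod (u : 'rV[int]_4) (z : V) :
    (forall i, (Posz c.+1 %| u 0%R i - Posz (z 0%R i))%Z) ->
    O (map_mx intr u *m E - lift z).
  move=> uz; have -> : map_mx intr u *m E - lift z = c.+1%:R *:
      (map_mx intr (\row_i ((u 0%R i - Posz (z 0%R i)) %/ c.+1)%Z) *m E) :> A.
    rewrite /lift -mulmxBl scalemxAl; congr (_ *m _); apply/rowP => i.
    have := congr1 (fun t : int => t%:~R : rat) (divzK (uz i)).
    by rewrite rmorphM rmorphB mulrC !mxE => /esym.
  by apply: cO; apply/O1E; eexists.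
have liftD (z z' : V) : O (lift (z + z') - (lift z + lift z')).
  have -> : lift z + lift z' =
      map_mx intr (map_mx (fun i : 'I_c.+1 => Posz i) z
                   + map_mx (fun i : 'I_c.+1 => Posz i) z') *m E.
    rewrite /lift -mulmxDl; congr (_ *m _); apply/rowP => i.
    by rewrite !mxE rmorphD.
  rewrite -opprB; apply/ON/lift_mod => i.
  by rewrite !mxE /= -modz_nat -eqz_mod_dvd modz_mod PoszD.
have N_gt0 : (0 < N)%N.
  have [y ys _] := s_surj 0 (order0 oO1).
  by rewrite -sN; case: (s) ys.
have pick_ord z : exists i : 'I_N, O (lift z - s`_i).
  have [y ys Oy] := s_surj _ (liftO1 z).
  have yN : (index y s < N)%N by rewrite -sN index_mem.
  by exists (Ordinal yN); rewrite /= nth_index.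
have pick_uniq z (i j : 'I_N) : O (lift z - s`_i) -> O (lift z - s`_j) -> i = j.
  move=> Oi Oj; apply: ord_inj; apply: s_inj => //.
  have -> : s`_i - s`_j = (lift z - s`_j) - (lift z - s`_i).
    by apply/rowP => k; rewrite !mxE; ring.
  exact: OB.
have [h hP] : exists h : V -> 'I_N, forall z, O (lift z - s`_(h z)).
  by have [h hP] := fin_all_exists pick_ord; exists h.
have hE z i : (h z == i) = `[< O (lift z - s`_i) >].
  apply/eqP/asboolP => [<-|Oi]; first exact: hP.
  exact: pick_uniq (hP z) Oi.
pose K := [set z | `[< O (lift z) >]].
(* The fibre over i is the translate of the kernel [K] by [z0], a reduction modulo c + 1 of the
   coordinates of the representative of index i. *)
have fiber (i : 'I_N) : #|[set z | h z == i]| = #|K|.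
  have si : s`_i \in s by rewrite mem_nth // sN.
  have [u sE] := (O1E _).1 (sO1 _ si).
  have c0 : Posz c.+1 != 0 by [].
  pose z0 : V := \row_j inord (absz (u 0%R j %% c.+1)%Z).
  have Oz0 : O (s`_i - lift z0).
    rewrite sE; apply: lift_mod => j; rewrite mxE inordK; last first.
      by rewrite -ltz_nat gez0_abs ?modz_ge0 // ltz_pmod.
    by rewrite gez0_abs ?modz_ge0 // -eqz_mod_dvd modz_mod.
  rewrite -(card_imset K (addIr z0)); apply: eq_card => z.
  rewrite inE hE; apply/asboolP/imsetP => [Oz|[y]].
    exists (z - z0); last by rewrite subrK.
    rewrite inE; apply/asboolP.
    have -> : lift (z - z0) = (lift z - s`_i) + (s`_i - lift z0)
        - (lift (z - z0 + z0) - (lift (z - z0) + lift z0)).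
      rewrite subrK; apply/rowP => j; rewrite !mxE; ring.
    by apply: OB; [apply: OD | apply: liftD].
  rewrite inE => /asboolP Oy ->.
  have -> : lift (y + z0) - s`_i = (lift (y + z0) - (lift y + lift z0)) + lift y
      - (s`_i - lift z0).
    by apply/rowP => j; rewrite !mxE; ring.
  by apply: OB; [apply: OD | ].
have -> : (c.+1 ^ 4)%N = #|V| by rewrite card_mx card_ord mul1n.
rewrite -sum1_card (partition_big h xpredT) //=.
rewrite (eq_bigr (fun=> #|K|)) => [|i _]; last first.
  by rewrite -(fiber i) -sum1dep_card.
by rewrite sum_nat_const card_ord dvdn_mulr.
Qed.

(** A nonzero scalar part would force the pure part to vanish, leaving a rational number with
    negative square. *)
Lemma pure_of_sqr x (n : rat) : 0 < n -> x * x = (- n)%:A -> qc 0 x = 0.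
Proof.
move=> n0 xx; apply/eqP; apply: contraT => x0.
have d0 (r : rat) : qc 0 x * r + r * qc 0 x = 0 -> r = 0.
  have -> : qc 0 x * r + r * qc 0 x = 2%:R * qc 0 x * r by ring.
  by move=> /eqP; rewrite !mulf_eq0 (negPf x0) => /eqP.
have /quatP[] := xx; rewrite !qE mulr1 mulr0 => e0 e1 e2 e3.
have x1 : qc 1 x = 0 by apply: d0; rewrite -[RHS]e1; ring.
have x2 : qc 2 x = 0 by apply: d0; rewrite -[RHS]e2; ring.
have x3 : qc 3 x = 0 by apply: d0; rewrite -[RHS]e3; ring.
move: e0; rewrite x1 x2 x3 => e0.
have : 0 <= qc 0 x * qc 0 x by rewrite -expr2 sqr_ge0.
have -> : qc 0 x * qc 0 x = - n by rewrite -e0; ring.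
by rewrite oppr_ge0 leNgt n0.
Qed.

Lemma pure_anticomm x y : qc 0 x = 0 -> qc 0 y = 0 ->
  x * y + y * x = (trd (x * y))%:A.
Proof. by move=> x0 y0; apply/quatP; rewrite /trd !qE x0 y0; split; ring. Qed.

(** * The order generated by a square root of -1 and a square root of -m *)

Section SqrtPair.
Variables (m t : rat) (W1 W2 : A).
Hypotheses (W11 : W1 * W1 = -1) (W22 : W2 * W2 = (- m)%:A).
Hypothesis W12 : W1 * W2 + W2 * W1 = t%:A.
(** Gram-Schmidt applied to [W2] against [W1], doubled to keep the coefficients integral. *)
Let V := 2%:R *: W2 + t *: W1.
Let c := 4%:R * m - t ^+ 2.

Let W21 : W2 * W1 = t%:A - W1 * W2.
Proof. by rewrite -W12 addrC addKr. Qed.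

Let lincomb (u v : A) : (forall i, u 0 i = v 0 i) -> u = v.
Proof. by move=> uv; apply/rowP. Qed.

Lemma pair_anticomm : V * W1 = - (W1 * V).
Proof.
rewrite /V mulrDl mulrDr -!(scalerAl, scalerAr) W21 W11.
move: (W1 * W2) (1 : A) => w o; apply: lincomb => i; rewrite !mxE; ring.
Qed.

Lemma pair_sqr : V * V = (- c)%:A.
Proof.
rewrite /V /c !mulrDl !mulrDr -!(scalerAl, scalerAr) W21 W11 W22.
move: (W1 * W2) (1 : A) => w o; apply: lincomb => i; rewrite !mxE; ring.
Qed.

(* The coefficients come from the basis of the order generated by W1 and W2
   dual to 1, W1, W2, W1 W2 for the trace form, scaled by c. *)
Lemma pair_dual (y : A) : c != 0 ->
  c *: y = (2%:R * m * trd y - t ^+ 2 * trd y + t * trd (y * (W1 * W2)))%:A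
    - (2%:R * m * trd (y * W1) + t * trd (y * W2)) *: W1
    - (2%:R * trd (y * W2) + t * trd (y * W1)) *: W2
    - (2%:R * trd (y * (W1 * W2)) - t * trd y) *: (W1 * W2).
Proof.
move=> c0; have n2 : (2%:R : rat) != 0 by [].
have N1 : (-1 : rat) != 0 by [].
have cN : - c != 0 by rewrite oppr_eq0.
have W11' : W1 * W1 = (-1)%:A by rewrite W11 scaleNr scale1r.
(* In the basis 1, [W1], [V], [W1 * V] the trace form is diagonal, so each trace computed below
   reads off one coordinate of [y]. *)
have [x <-] := qembed_surj n2 N1 cN W11' pair_sqr pair_anticomm y.
have VV := pair_sqr; have VW := pair_anticomm.
have trW1 : trd W1 = 0.
  by apply: (trd_anticomm n2 cN VV); rewrite VW opprK.
have trV : trd V = 0 by apply: (trd_anticomm n2 N1 W11').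
have trW1V : trd (W1 * V) = 0.
  apply: (trd_anticomm n2 N1 W11').
  by rewrite -mulrA VW mulrN.
have W2E : W2 = 2%:R^-1 *: V - (t / 2%:R) *: W1.
  by rewrite /V; apply: lincomb => i; rewrite !mxE; field.
have W12E : W1 * W2 = 2%:R^-1 *: (W1 * V) + (t / 2%:R)%:A.
  rewrite {1}W2E mulrBr -!scalerAr W11; move: (W1 * V) (1 : A) => w o.
  by apply: lincomb => i; rewrite !mxE; ring.
have tr1 : trd (qembed W1 V x) = 2%:R * qc 0 x.
  by rewrite /qembed !(trdD, trdZ, trdN, trW1, trV, trW1V, trd1); ring.
have WV1 : (W1 * V) * W1 = V by rewrite -mulrA VW mulrN mulrA W11 mulN1r opprK.
have VWV : V * (W1 * V) = c *: W1.
  rewrite mulrA VW mulNr -mulrA VV -scalerAr mulr1 scaleNr opprK //.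
have WVV : W1 * V * V = (- c) *: W1 by rewrite -mulrA VV -scalerAr mulr1.
have WWV : W1 * (W1 * V) = - V by rewrite mulrA W11 mulN1r.
have WVWV : W1 * V * (W1 * V) = (- c)%:A by rewrite mulrA WV1 VV.
have trX1 : trd (qembed W1 V x * W1) = - (2%:R * qc 1 x).
  rewrite /qembed !mulrDl -!scalerAl !mul1r W11 VW WV1.
  by rewrite !(trdD, trdZ, trdN, trW1, trV, trW1V, trd1); ring.
have trXV : trd (qembed W1 V x * V) = - (2%:R * c * qc 2 x).
  rewrite /qembed !mulrDl -!scalerAl !mul1r VV WVV.
  by rewrite !(trdD, trdZ, trdN, trW1, trV, trW1V, trd1); ring.
have trX1V : trd (qembed W1 V x * (W1 * V)) = - (2%:R * c * qc 3 x).
  rewrite /qembed !mulrDl -!scalerAl !mul1r WVWV WWV VWV.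
  by rewrite !(trdD, trdZ, trdN, trW1, trV, trW1V, trd1); ring.
have trX2 : trd (qembed W1 V x * W2) = - (c * qc 2 x) + t * qc 1 x.
  rewrite {1}W2E mulrBr -!scalerAr trdD -scaleNr !trdZ trXV trX1.
  by field.
have trX12 : trd (qembed W1 V x * (W1 * W2)) = - (c * qc 3 x) + t * qc 0 x.
  rewrite W12E mulrDr -!scalerAr mulr1 trdD !trdZ trX1V tr1.
  by field.
rewrite trX12 trX2 trX1 tr1 W12E {1}W2E /qembed.
move: (W1 * V) (1 : A) V W1 => w o v w1.
by apply: lincomb => i; rewrite !mxE /c; field.
Qed.

End SqrtPair.

End OrderTheory.

(** * From an embedded pair to the congruences *)

Section SquareFree.

Lemma squarefree_logn n p : 0 < n -> squarefree n -> prime p -> logn p n <= 1.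
Proof.
move=> n0 sq pp; rewrite leqNgt; apply/negP => l2.
by have /negP[] := sq p pp; rewrite pfactor_dvdn.
Qed.

Lemma squarefree_dvd m n : 0 < m -> squarefree m ->
  (forall p, prime p -> p %| m -> p %| n) -> m %| n.
Proof.
move=> m0 sq mn; apply/dvdn_partP => // p;
  rewrite mem_primes => /and3P[pp _ pm].
rewrite p_part; have := squarefree_logn m0 sq pp.
by case: (logn p m) => [|[|]] // _; rewrite expn1 mn.
Qed.

Lemma squarefree_dvdr m n : squarefree n -> m %| n -> squarefree m.
Proof. by move=> sq mn p pp; apply: contra (sq p pp) => /dvdn_trans; apply. Qed.

Lemma squarefree_mul m n : coprime m n -> squarefree m -> squarefree n ->
  squarefree (m * n).
Proof.
move=> cop sqm sqn p pp.
have [pm|pm] := boolP (p %| m).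
  have pn : coprime (p ^ 2) n.
    by rewrite coprime_pexpl //; apply: coprime_dvdl pm cop.
  by rewrite Gauss_dvdl // sqm.
by rewrite Gauss_dvdr ?sqn // coprime_pexpl // prime_coprime.
Qed.

Lemma dvdn_prod_seq p (s : seq nat) : prime p -> p %| \prod_(x <- s) x ->
  exists2 x, x \in s & p %| x.
Proof.
move=> pp; elim: s => [|x s IHs].
  by rewrite big_nil dvdn1 => /eqP p1; rewrite p1 in pp.
rewrite big_cons Euclid_dvdM // => /orP[px|/IHs[y ys py]].
  by exists x; rewrite ?mem_head.
by exists y; rewrite // inE ys orbT.
Qed.

End SquareFree.

Lemma primes_discriminant a b D p : has_discriminant a b D -> 0 < D ->
  p \in primes D <-> ramified_at a b p.
Proof.
move=> [s [_ sP DE]] D0; rewrite -sP mem_primes D0 /=.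
split=> [/andP[pp]|ps].
  rewrite DE => /(dvdn_prod_seq pp)[x xs px].
  have [px' _] := (sP x).1 xs.
  by move: px; rewrite dvdn_prime2 // => /eqP->.
have [pp _] := (sP p).1 ps; rewrite pp DE /=.
by rewrite (big_rem p ps) dvdn_mulr.
Qed.

Section Necessity.
Local Open Scope ring_scope.
Variables (D N m : nat).
Hypotheses (D0 : (0 < D)%N) (N0 : (0 < N)%N) (sqD : squarefree D)
  (sqN : squarefree N) (copDN : coprime D N) (oddD : odd (size (primes D)))
  (m1 : (1 < m)%N) (mDN : (m %| D * N)%N).

Let sqDN : squarefree (D * N) := squarefree_mul copDN sqD sqN.
Let sqm : squarefree m := squarefree_dvdr sqDN mDN.
Let DN0 : (0 < D * N)%N. Proof. by rewrite muln_gt0 D0. Qed.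

Lemma squarefree_dvdz_sqr (t : int) : (m %| t ^+ 2)%Z -> exists s : int,
  t = s * Posz m.
Proof.
rewrite dvdzE /= abszX => mt.
suff /dvdzP : (m %| t)%Z by [].
rewrite dvdzE /=.
apply: squarefree_dvd => //; first by lia.
move=> p pp pm.
by have := dvdn_trans pm mt; rewrite Euclid_dvdX // => /andP[].
Qed.

(** If t^2 = 4 m then m, being square-free, divides t; with t = s m this gives s^2 m = 4, so m would
    be 1 or 4. *)
Lemma pair_disc_neq0 (t : int) : 4 * Posz m - t ^+ 2 != 0.
Proof.
apply/eqP => /eqP; rewrite subr_eq0 => /eqP tm.
have [|s ts] := @squarefree_dvdz_sqr t; first by rewrite -tm dvdz_mull.
have m0 : Posz m != 0 by lia.
have {tm} sm : (`|s| ^ 2 * m = 4)%N.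
  apply/eqP; rewrite -eqz_nat PoszM -abszX gez0_abs ?sqr_ge0 //.
  by apply/eqP; apply: (mulIf m0); rewrite tm ts; ring.
have m4 : m != 4%N.
  by apply/negP => /eqP m4; have := sqm (isT : prime 2); rewrite m4.
move: sm; case: (`|s|%N) => [|[|[|n]]] //; rewrite !expnS; nia.
Qed.

(** With t = s m and D N = k m, the divisibility becomes k | 4 - m s^2, a positive number. For s = 0
    this leaves k = 1 or 2, since 4 does not divide D N; otherwise s^2 = 1, m is 2 or 3, and k =
    1. *)
Lemma level_disc (t : int) : 0 < 4 * Posz m - t ^+ 2 ->
  (Posz (D * N) %| 4 * Posz m - t ^+ 2)%Z ->
  (t = 0 /\ (D * N = m \/ D * N = 2 * m)%N) \/
  (N = 1 /\ D = m)%N.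
Proof.
move=> c0 dc; have [k DNE] := dvdnP mDN.
have mz : Posz m != 0 by lia.
have k0 : (0 < k)%N by move: DN0; rewrite DNE muln_gt0 => /andP[].
have k4 : k != 4.
  apply/negP => /eqP k4; have := sqDN (isT : prime 2).
  by rewrite DNE k4 dvdn_mulr.
have md : (m %| 4 * Posz m - t ^+ 2)%Z.
  by apply: dvdz_trans dc; rewrite dvdzE.
have [|s ts] := @squarefree_dvdz_sqr t.
  by rewrite -[t ^+ 2](subKr (4 * Posz m)) rpredB // dvdz_mull.
have cE : 4 * Posz m - t ^+ 2 = (4 - Posz m * s ^+ 2) * m by rewrite ts; ring.
have kd : (k %| 4 - Posz m * s ^+ 2)%Z.
  by move: dc; rewrite cE DNE PoszM dvdz_mul2r.
have c0' : 0 < 4 - Posz m * s ^+ 2.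
  by move: c0; rewrite cE pmulr_lgt0 // ltz_nat; lia.
have [s0|s0] := eqVneq s 0.
  left; split; first by rewrite ts s0 mul0r.
  move: kd; rewrite s0 expr0n mulr0 subr0 dvdzE /= => kd.
  rewrite DNE; have : (k <= 4)%N by apply: dvdn_leq.
  move: k0 k4 kd; case: (k) => [|[|[|[|[|]]]]] // _ _ _ _; [left|right]; lia.
right.
have s1 : s ^+ 2 = 1.
  have : (1 <= s ^+ 2) by rewrite -gtz0_ge1 exprn_even_gt0.
  have m2 : 2 <= Posz m by lia.
  move: (s ^+ 2) c0' => x c0' x1; have : ~~ (2 <= x); last by lia.
  apply/negP => x2; have : 2 * 2 <= Posz m * x by apply: ler_pM.
  by move: c0'; move: (Posz m * x); lia.
move: kd c0'; rewrite s1 mulr1 => kd c0'.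
have DNm : (D * N = m)%N /\ ((m = 2) \/ (m = 3))%N.
  have [m2|m3] : (m = 2 \/ m = 3)%N by lia.
    move: kd; rewrite m2 dvdzE /= => kd; have : (k <= 2)%N by apply: dvdn_leq.
    have k2 : k != 2.
      apply/negP => /eqP k2; have := sqDN (isT : prime 2).
      by rewrite DNE k2 m2.
    by move: k0 k2; rewrite DNE m2; case: (k) => [|[|[|]]] //= _ _ _;
      split=> //; left.
  move: kd; rewrite m3 dvdzE /= dvdn1 => /eqP k1; rewrite DNE k1 m3.
  by split=> //; right.
(* [D] has an odd number of prime factors, so it is the nontrivial factor of the prime D N. *)
have D1 : D <> 1%N by move=> D1; move: oddD; rewrite D1.
case: DNm => DNm mE; have pm : prime m by case: mE => ->.
have /primeP[_ /(_ D)] := pm;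
  rewrite -{1}DNm dvdn_mulr // => /(_ isT)/orP[/eqP//|].
move=> /eqP DM; split=> //; apply/eqP.
by rewrite -(eqn_pmul2l D0) muln1 DNm DM.
Qed.

Section Orders.
Variables (a b : rat) (O : set (quat a b)) (w1 w2 : quat a b).
Hypotheses (defab : definite a b) (discD : has_discriminant a b D)
  (eichO : eichler_order O N) (Ow1 : O w1) (Ow2 : O w2)
  (w11 : w1 * w1 = - 1) (w22 : w2 * w2 = (- m%:R)%:A).

Lemma eichler_pair_disc : exists t : int,
  [/\ 0 < 4 * Posz m - t ^+ 2, (Posz (D * N) %| 4 * Posz m - t ^+ 2)%Z
    & forall p, ramified_at a b p <-> exists pp : prime p,
        division_algebra (quat (-1) ((- (4 * Posz m - t ^+ 2))%:~R : padic
          pp))].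
Proof.
have [O1 [O2 [[oO1 _] [oO2 _] OE ind _]]] := eichO.
have OP x : O x <-> O1 x /\ O2 x by rewrite OE.
have [[O1w1 O2w1] [O1w2 O2w2]] := ((OP _).1 Ow1, (OP _).1 Ow2).
have pw1 : qc 0 w1 = 0.
  by apply: (@pure_of_sqr _ _ _ 1); rewrite // scaleNr scale1r.
have pw2 : qc 0 w2 = 0 by apply: (pure_of_sqr _ w22); rewrite ltr0n; lia.
have O1M := let: And4 _ _ H _ := oO1 in H.
have [t tE] := order_trd oO1 (O1M _ _ O1w1 O1w2).
have w12 : w1 * w2 + w2 * w1 = (t%:~R)%:A by rewrite -tE pure_anticomm.
pose c := 4 * Posz m - t ^+ 2; have c0 : c != 0 := pair_disc_neq0 t.
have cE : 4%:R * m%:R - t%:~R ^+ 2 = c%:~R :> rat by rewrite /c rmorphB rmorphM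
  rmorphXn.
have VV := pair_sqr w11 w22 w12; have VW := pair_anticomm w11 w12.
rewrite cE -rmorphN /= in VV.
have Nc0 : - c != 0 by rewrite oppr_eq0.
have c_gt0 : 0 < c by have := definite_lt0 Nc0 w11 VV VW defab;
  rewrite oppr_lt0.
exists t; have ram p := ramified_atP Nc0 w11 VV VW p; split=> //.
(* [pair_dual] expands c y with coefficients that are polynomials in integral traces, and 1, [w1],
   [w2], [w1 * w2] lie in both maximal orders. *)
have sub y : O1 y -> O (c%:~R *: y).
  move=> O1y; have [k0 k0E] := order_trd oO1 O1y.
  have [k1 k1E] := order_trd oO1 (O1M _ _ O1y O1w1).
  have [k2 k2E] := order_trd oO1 (O1M _ _ O1y O1w2).
  have [k3 k3E] := order_trd oO1 (O1M _ _ O1y (O1M _ _ O1w1 O1w2)).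
  rewrite -cE (pair_dual w11 w22 w12) ?cE ?intr_eq0 // k0E k1E k2E k3E.
  rewrite -[2%:R]/((2 : int)%:~R) -[m%:R]/((Posz m)%:~R).
  rewrite -!(rmorphM, rmorphXn, rmorphB, rmorphD) /=.
  have comb (O' : set (quat a b)) (z0 z1 z2 z3 : int) : is_order O' -> O' w1 ->
    O' w2 ->
      O' (z0%:~R%:A - z1%:~R *: w1 - z2%:~R *: w2 - z3%:~R *: (w1 * w2)).
    move=> oO' Ow1' Ow2'; have [_ OB OM _] := oO'.
    by do 3!(apply: (OB); last by apply: orderZ => //; apply: OM);
      apply: order_int.
  by apply/OP; split; apply: comb.
have OB x y : O x -> O y -> O (x - y).
  case: oO1 oO2 => _ OB1 _ _ [_ OB2 _ _].
  by move=> /OP[x1 x2] /OP[y1 y2]; apply/OP; split; [apply: OB1|apply: OB2].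
(* The quotient O1 / O is killed by c and has order N, so N divides c^4. *)
have Nc q : prime q -> (q %| N)%N -> (q %| c)%Z.
  move=> pq qN; have [k ck] : exists k : nat, c = Posz k.+1.
    by exists (`|c|.-1)%N; rewrite prednK ?absz_gt0 // gtz0_abs.
  rewrite ck in sub *; have := has_index_dvd oO1 OB ind sub.
  by move=> /(dvdn_trans qN); rewrite Euclid_dvdX // => /andP[].
(* A prime not dividing c is unramified. For q = 2, c odd makes t odd, and then - c = t^2 - 4 m is 1
   modulo 4. *)
have Dc q : prime q -> (q %| D)%N -> (q %| c)%Z.
  move=> pq qD; apply: contraT => qc.
  have : q \in primes D by rewrite mem_primes pq D0.
  move=> /(primes_discriminant _ discD D0)/ram[pq' dq].
  have [q2|q_odd] := even_prime pq.
    have tc : (4 %| - c - 1)%Z.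
      have t_odd : ~~ (2 %| t)%Z.
        apply: contra qc => /dvdzP[r tr]; rewrite q2 /c tr.
        by apply/dvdzP; exists (2 * Posz m - 2 * r ^+ 2); ring.
      have [u tu] : exists u, t = 2 * u + 1.
        by clear -t_odd; exists (t %/ 2)%Z; lia.
      by rewrite /c tu; apply/dvdzP; exists (u ^+ 2 + u - Posz m); ring.
    by case: (dyadic_not_division q2 tc dq).
  have qNc : ~~ (q %| - c)%Z by rewrite rpredN.
  by case: (unit_not_division q_odd qNc dq).
rewrite dvdzE /=; apply: squarefree_dvd => // q pq.
by rewrite Euclid_dvdM // => /orP[/(Dc _ pq)|/(Nc _ pq)]; rewrite dvdzE.
Qed.

Lemma eichler_pair_necessary :
  [/\ m = (D * N)%N \/ ((2 %| D * N)%N /\ m = (D * N %/ 2)%N),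
      forall p : nat, p \in primes D -> p = 2%N \/ p = 3 %[mod 4]
    & forall q : nat, q \in primes N -> q = 2%N \/ q = 1 %[mod 4]].
Proof.
have [t [c0 dc ram]] := eichler_pair_disc.
have ramD p := primes_discriminant p discD D0.
have odd4 p : odd p -> p = 1 %[mod 4] \/ p = 3 %[mod 4].
  by clear; lia.
split.
- have [[_ [DNm|DNm]]|[N1 DM]] := level_disc c0 dc; first by left.
    by right; rewrite DNm dvdn_mulr // mulKn.
  by left; rewrite N1 DM muln1.
- move=> p pD; have [pq dp] := (ram p).1 ((ramD p).1 pD).
  have [->|p_odd] := even_prime pq; first by left.
  have [p1|p3] := odd4 p p_odd; last by right.
  by case: (sqrt_not_division p1 dp).
move=> q; rewrite mem_primes => /and3P[pq _ qN].
have [->|q_odd] := even_prime pq; first by left.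
have [q1|q3] := odd4 q q_odd; [by right | exfalso].
(* Here t = 0 and q divides m exactly once, so (-1, -4 m) ramifies at q; then q divides D as well as
   N, against coprimality. *)
have qDN : (q %| D * N)%N by rewrite dvdn_mull.
have [[t0 DNm]|[N1 _]] := level_disc c0 dc; last first.
  by move: qN; rewrite N1 dvdn1 => /eqP q1; rewrite q1 in pq.
have qm : (q %| m)%N.
  case: DNm => DNm; first by rewrite -DNm.
  by move: qDN; rewrite DNm Gauss_dvdr // coprime_sym coprime2n.
have [r mr] := dvdnP qm.
have qr : ~~ (q %| r)%N.
  apply/negP => /dvdnP[u ru]; have := sqm pq.
  by rewrite mr ru -mulnA mulnn dvdn_mull.
have : ramified_at a b q.
  apply/ram; exists pq; rewrite t0 expr0n subr0 mr.
  have -> : 4 * Posz (r * q) = Posz q * (4 * Posz r) by rewrite PoszM; ring.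
  apply: odd_division => //.
  have q4 : ~~ (q %| 4)%N.
    apply/negP => q4; have := @dvdn_leq q 4 isT q4.
    by case: (q) pq q_odd q4 => [|[|[|[|[|]]]]].
  by rewrite dvdzE abszM Euclid_dvdM // negb_or qr andbT.
move=> /ramD; rewrite mem_primes => /and3P[_ _ qD].
have := dvdn_gcd q D N; rewrite qD qN (eqP copDN) dvdn1 => /eqP q1.
by rewrite q1 in pq.
Qed.

End Orders.

End Necessity.

(** * From the congruences to an embedded pair *)

Section PrimeProducts.

Lemma squarefree_prod_primes n : 0 < n -> squarefree n ->
  n = \prod_(p <- primes n) p.
Proof.
move=> n0 sq; rewrite [LHS]prod_prime_decomp // prime_decompE big_map.
apply: eq_big_seq => p; rewrite mem_primes => /and3P[pp _ pn] /=.
have := squarefree_logn n0 sq pp;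
  have : 0 < logn p n by rewrite logn_gt0 mem_primes pp n0.
by case: (logn p n) => [|[|]].
Qed.

Lemma prod_mod4_1 (s : seq nat) : (forall p, p \in s -> p = 1 %[mod 4]) ->
  \prod_(p <- s) p = 1 %[mod 4].
Proof.
elim: s => [|p s IHs] sP; first by rewrite big_nil.
rewrite big_cons -modnMm (sP p) ?mem_head // IHs // => q qs.
by apply: sP; rewrite inE qs orbT.
Qed.

Lemma prod_mod4_3 (s : seq nat) : (forall p, p \in s -> p = 3 %[mod 4]) ->
  \prod_(p <- s) p = (if odd (size s) then 3 else 1) %[mod 4].
Proof.
elim: s => [|p s IHs] sP; first by rewrite big_nil.
rewrite big_cons -modnMm (sP p) ?mem_head // IHs => [|q qs].
  by rewrite /=; case: (odd (size s)).
by apply: sP; rewrite inE qs orbT.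
Qed.

(** Chinese remainders along the list: with u p + v n = 1, the combination chosen is [x] modulo p
    and [y] modulo n. *)
Lemma sqrt_minus1_prod (s : seq nat) : uniq s ->
  (forall p, p \in s -> prime p /\ p = 1 %[mod 4]) ->
  exists x : int, (Posz (\prod_(p <- s) p) %| (x ^+ 2 + 1)%R)%Z.
Proof.
elim: s => [|p s IHs] /=; first by exists 0%R; rewrite big_nil dvd1z.
move=> /andP[ps us] sP.
have [y yP] := IHs us (fun q qs => sP q (mem_behead (s := p :: s) qs)).
have [pp p1] := sP p (mem_head _ _); have [x xP] := sqrt_minus1_mod pp p1.
have cop : coprime p (\prod_(q <- s) q).
  rewrite prime_coprime //; apply/negP => /(dvdn_prod_seq pp)[q qs].
  have [pq _] := sP q (mem_behead (s := p :: s) qs).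
  by rewrite dvdn_prime2 // => /eqP pq'; rewrite pq' qs in ps.
rewrite big_cons; move: (\prod_(q <- s) q) yP cop => n yP cop.
have [[u v] /= uv] := coprimezP (Posz p) (Posz n) cop.
exists (y * (u * p) + x * (v * n))%R.
have vE : (v * Posz n = 1 - u * Posz p)%R by rewrite -uv addrC addKr.
have uE : (u * Posz p = 1 - v * Posz n)%R by rewrite -uv addrK.
rewrite PoszM Gauss_dvdz //; apply/andP; split.
  have -> : ((y * (u * Posz p) + x * (v * Posz n)) ^+ 2 + 1
    = (x ^+ 2 + 1) + (u * (y - x) * (2 * x + u * Posz p * (y - x))) * Posz p)%R.
    by rewrite vE; ring.
  by rewrite rpredD // dvdz_mull.
have -> : ((y * (u * Posz p) + x * (v * Posz n)) ^+ 2 + 1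
    = (y ^+ 2 + 1) + (v * (x - y) * (2 * y + v * Posz n * (x - y))) * Posz n)%R.
  by rewrite uE; ring.
by rewrite rpredD // dvdz_mull.
Qed.

Lemma odd_double_primes n : odd n -> perm_eq (primes (2 * n)) (2 :: primes n).
Proof.
move=> n_odd; have n0 : 0 < n by case: n n_odd.
apply: uniq_perm; rewrite ?primes_uniq //=.
  by rewrite primes_uniq mem_primes /= dvdn2 n_odd andbF.
by move=> p; rewrite primesM // inE; congr (_ || _);
  rewrite primes_prime // inE.
Qed.

End PrimeProducts.

(** * Orders from multiplication tables, conjugate orders, cyclic quotients *)

Section OrderConstructions.
Local Open Scope ring_scope.
Variables (a b : rat).
Local Notation A := (quat a b).
Implicit Types (O : set A) (x y : A).

(** By bilinearity, closure under products only needs the table of the e_i e_j, so an order can be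
    given by structure constants. *)
Lemma order_of_basis (e : 'I_4 -> A) :
  (forall v : 'I_4 -> rat, \sum_i v i *: e i = 0 -> forall i, v i = 0) ->
  (exists z : 'I_4 -> int, 1 = \sum_i (z i)%:~R *: e i) ->
  (forall i j, exists z : 'I_4 -> int, e i * e j = \sum_k (z k)%:~R *: e k) ->
  is_order [set y | exists z : 'I_4 -> int,
    y = \sum_i (z i)%:~R *: e i]%classic.
Proof.
move=> free_e e1 eM; set O := (X in is_order X).
pose E : 'M[rat]_4 := \matrix_(i, j) e i 0 j.
have mulE (v : 'rV[rat]_4) : v *m E = \sum_i v 0 i *: e i.
  rewrite mulmx_sum_row; apply: eq_bigr => i _; congr (_ *: _).
  by apply/rowP => j; rewrite !mxE.
have OD x y : O x -> O y -> O (x + y).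
  move=> [z ->] [t ->]; exists (fun i => z i + t i).
  by rewrite -big_split; apply: eq_bigr => i _; rewrite rmorphD scalerDl.
have OZ (n : int) x : O x -> O (n%:~R *: x).
  move=> [z ->]; exists (fun i => n * z i).
  by rewrite scaler_sumr; apply: eq_bigr => i _; rewrite scalerA rmorphM.
have Osum (f : 'I_4 -> A) : (forall i, O (f i)) -> O (\sum_i f i).
  move=> Of; apply: big_ind => //.
  by exists (fun=> 0); rewrite big1 // => i _; rewrite scale0r.
apply: (@lattice_order _ _ _ E) => //.
- rewrite -row_free_unit; apply: inj_row_free => v; rewrite mulE => /free_e v0.
  by apply/rowP => i; rewrite v0 mxE.
- move=> y; split=> [[z ->]|[z ->]].
    exists (\row_i z i); rewrite mulE; apply: eq_bigr => i _.
    by rewrite !mxE.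
  by exists (fun i => z 0 i); rewrite mulE; apply: eq_bigr => i _; rewrite mxE.
move=> x y [z ->] [t ->]; rewrite mulr_suml; apply: (Osum) => i.
rewrite mulr_sumr; apply: Osum => j; rewrite -scalerAl -scalerAr.
by apply/OZ/OZ/eM.
Qed.

Section Involution.
Variable tau : A -> A.
Hypotheses (tauK : forall x, tau (tau x) = x)
  (tauD : forall x y, tau (x + y) = tau x + tau y)
  (tauZ : forall (c : rat) x, tau (c *: x) = c *: tau x)
  (tauM : forall x y, tau (x * y) = tau x * tau y).

Let tau_sum (f : 'I_4 -> A) : tau (\sum_i f i) = \sum_i tau (f i).
Proof.
have tau0 : tau 0 = 0 by have := tauZ 0 0; rewrite !scale0r.
exact: (big_morph tau tauD tau0).
Qed.

Let tau1 : tau 1 = 1.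
Proof. by rewrite -[LHS]mulr1 -{2}(tauK 1) -tauM mul1r tauK. Qed.

Let tauB x y : tau (x - y) = tau x - tau y.
Proof. by rewrite tauD -scaleN1r tauZ scaleN1r. Qed.

(** If [E] is a basis matrix of [O] and [T] the matrix of [tau], then E T is one for the preimage,
    because T^2 = 1. *)
Lemma order_involution O : is_order O -> is_order [set y | O (tau y)]%classic.
Proof.
move=> oO; have [E uE OE] := order_lattice oO; have [O1 OB OM _] := oO.
pose T : 'M[rat]_4 := \matrix_(i, j) (tau (row i 1%:M)) 0 j.
have TE (y : A) : y *m T = tau y.
  rewrite mulmx_sum_row -[in RHS](mulmx1 y) [in RHS]mulmx_sum_row tau_sum.
  apply: eq_bigr => i _; rewrite tauZ; congr (_ *: _).
  by apply/rowP => j; rewrite !mxE.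
have TT : T *m T = 1%:M.
  apply/row_matrixP => i; rewrite row_mul TE -[row i T](_ : tau (row i 1%:M) =
    _) ?tauK //.
  by apply/rowP => j; rewrite !mxE.
have uT : T \in unitmx by case: (mulmx1_unit TT).
apply: (@lattice_order _ _ _ (E *m T)) => /=.
- by rewrite unitmx_mul uE.
- move=> x; rewrite OE; split=> -[z zE]; exists z.
    by rewrite mulmxA -zE TE tauK.
  by rewrite -TE zE -!mulmxA TT mulmx1.
- by rewrite tau1.
by move=> x y Ox Oy; rewrite tauM; apply: OM.
Qed.

Lemma maximal_involution O :
  maximal_order O -> maximal_order [set y | O (tau y)]%classic.
Proof.
move=> [oO mO]; split; first exact: order_involution.
move=> O' oO' OO'; have := mO _ (order_involution oO').
have sub : (O `<=` [set y | O' (tau y)])%classic.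
  by move=> y Oy; apply: OO'; rewrite /= tauK.
move=> /(_ sub) OE; apply/seteqP; split=> y /=; last exact: OO'.
by rewrite -OE /= tauK.
Qed.

Lemma has_index_involution O O' N : (forall y, O' (tau y) <-> O' y) ->
  has_index O O' N -> has_index [set y | O (tau y)]%classic O' N.
Proof.
move=> O'tau [s [sN sO s_inj s_surj]]; exists (map tau s); split.
- by rewrite size_map.
- by move=> x /mapP[y ys ->] /=; rewrite tauK; apply: sO.
- move=> i j iN jN; rewrite !(nth_map 0) ?sN // -tauB => /O'tau.
  exact: s_inj.
move=> x /= /s_surj[y ys yx]; exists (tau y); first by rewrite map_f.
by apply/O'tau; rewrite tauB tauK.
Qed.

End Involution.

(** The last hypothesis says that O / O' is cyclic of order N, generated by [v], with [y] in the
    class of n v; the multiples of [v] by 0, ..., N - 1 are then representatives. *)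
Lemma has_index_cyclic O O' N (v : A) : (0 < N)%N -> is_order O -> O' 0 ->
  O v ->
  (forall y, O y -> exists n : int, forall k : int,
     O' (y - k%:~R *: v) <-> (Posz N %| n - k)%Z) ->
  has_index O O' N.
Proof.
move=> N0 oO O'0 Ov H.
have sE i : (i < N)%N -> (mkseq (fun i => i%:R *: v) N)`_i = (Posz i)%:~R *: v.
  by move=> iN; rewrite nth_mkseq.
exists (mkseq (fun i => i%:R *: v) N); split.
- by rewrite size_mkseq.
- by move=> x /mapP[i _ ->]; apply: (@orderZ _ _ _ _ (Posz i)).
- move=> i j iN jN; rewrite !sE // => Oij.
  have [n nP] := H _ (orderZ (Posz i) oO Ov).
  have ni : (Posz N %| n - Posz i)%Z by apply/nP; rewrite subrr.
  have nj := (nP _).1 Oij.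
  have : (Posz N %| Posz i - Posz j)%Z.
    by rewrite -[_ - _](subrKA n) -opprB rpredD // rpredN.
  by rewrite -eqz_mod_dvd !modz_nat eqz_nat !modn_small // => /eqP.
move=> x /H[n nP]; pose r := absz (n %% N)%Z.
have Nz : Posz N != 0 by lia.
have rE : Posz r = (n %% N)%Z by rewrite gez0_abs ?modz_ge0.
have rN : (r < N)%N by rewrite -ltz_nat rE ltz_pmod.
exists ((Posz r)%:~R *: v).
  by apply/mapP; exists r; rewrite ?mem_iota.
by apply/nP; rewrite rE -eqz_mod_dvd modz_mod.
Qed.

End OrderConstructions.

Lemma ord4_ind (P : 'I_4 -> Prop) :
  P (inord 0) -> P (inord 1) -> P (inord 2) -> P (inord 3) -> forall i, P i.
Proof.
by move=> P0 P1 P2 P3 i; rewrite -(inord_val i); case: i => [[|[|[|[|]]]]].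
Qed.

(** * The two lattices, in integer coordinates *)

Section Lattices.
Local Open Scope ring_scope.
Variables (dd nn x : int).
Hypothesis nn0 : nn != 0.
Local Notation A := (quat (-1 : rat) ((- (dd * nn))%:~R : rat)).

Let nnR : (nn%:~R : rat) != 0. Proof. by rewrite intr_eq0. Qed.

(* Here dd and nn stand for the odd parts of D and N, and x for a square root of
   -1 modulo nn. *)
Definition elt (al be ga de : int) : A :=
  mkq _ _ (al%:~R / 2%:R) (be%:~R / 2%:R) (ga%:~R / (2%:R * nn%:~R))
    (de%:~R / (2%:R * nn%:~R)).

Lemma el_inj al be ga de al' be' ga' de' : elt al be ga de = elt al' be' ga'
  de' ->
  [/\ al = al', be = be', ga = ga' & de = de'].
Proof.
have n20 : (2%:R * nn%:~R : rat) != 0 by rewrite mulf_neq0.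
have n2 : (2%:R : rat) != 0 by [].
have inj (u : rat) (z t : int) : u != 0 -> z%:~R / u = t%:~R / u -> z = t.
  by move=> u0 /(mulIf (invr_neq0 u0))/intr_inj.
by move=> /quatP; rewrite /elt !qE => -[/(inj _ _ _ n2)-> /(inj _ _ _ n2)->
  /(inj _ _ _ n20)-> /(inj _ _ _ n20)->].
Qed.

Lemma elB al be ga de al' be' ga' de' : elt al be ga de - elt al' be' ga' de' =
  elt (al - al') (be - be') (ga - ga') (de - de').
Proof. by apply/quatP; rewrite /elt !qE !rmorphB /=; split; ring. Qed.

Lemma elZ (k : int) al be ga de : k%:~R *: elt al be ga de =
  elt (k * al) (k * be) (k * ga) (k * de).
Proof. by apply/quatP; rewrite /elt !qE !rmorphM /=; split; ring. Qed.

Lemma el1 : elt 2 0 0 0 = 1.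
Proof. by apply/quatP; rewrite /elt !qE; split; rewrite ?mul0r //. Qed.

Section TypeI.

(* The basis 1, i, (1 + j) / 2, i / 2 + (k - x j) / (2 nn), for an even x; it
   spans an order when dd nn = 3 mod 4. *)
Definition basisI (i : 'I_4) : A :=
  nth 0 [:: elt 2 0 0 0; elt 0 2 0 0; elt 1 0 nn 0; elt 0 1 (- x) 1] i.

Lemma sum_basisI (z : 'I_4 -> int) : \sum_i (z i)%:~R *: basisI i =
  elt (2 * z (inord 0) + z (inord 2)) (2 * z (inord 1) + z (inord 3))
     (nn * z (inord 2) - x * z (inord 3)) (z (inord 3)).
Proof.
rewrite sum_ord4 /basisI !inordK //=; apply/quatP; rewrite /elt !qE.
by rewrite !(rmorphB, rmorphD, rmorphM, rmorphN) /=; split; ring.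
Qed.

Definition OI : set A :=
  [set y | exists z : 'I_4 -> int, y = \sum_i (z i)%:~R *: basisI i]%classic.

Hypotheses (nn_odd : ~~ (2 %| nn)%Z) (x_even : (2 %| x)%Z).

(** If ga = u nn - x de, with u the coefficient of (1 + j) / 2, then u and [ga] have the same parity
    since nn is odd and x even; so the condition on [al] can be stated with [ga]. *)
Lemma OI_el al be ga de : OI (elt al be ga de) <->
  [/\ (nn %| ga + x * de)%Z, (2 %| al - ga)%Z & (2 %| be - de)%Z].
Proof.
split=> [[z]|[/dvdzP[u uE] ag /dvdzP[w wE]]].
  rewrite sum_basisI => /el_inj[-> -> -> ->]; have [X xX] := dvdzP x_even.
  have [n nE] : exists n, nn = 2 * n + 1 by exists (nn %/ 2)%Z; lia.
  split; apply/dvdzP.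
  - by exists (z (inord 2)); ring.
  - exists (z (inord 0) - n * z (inord 2) + X * z (inord 3)).
    by rewrite nE xX; ring.
  - by exists (z (inord 1)); ring.
have /dvdzP[t tE] : (2 %| al - u)%Z.
  have [X xX] := dvdzP x_even.
  have [n nE] : exists n, nn = 2 * n + 1 by exists (nn %/ 2)%Z; lia.
  have [s sE] := dvdzP ag; apply/dvdzP; exists (s + n * u - X * de).
  have -> : al = s * 2 + ga by rewrite -sE; ring.
  have -> : ga = u * nn - x * de by rewrite -uE; ring.
  by rewrite nE xX; ring.
exists (fun k : 'I_4 => [:: t; w; u; de]`_k); rewrite sum_basisI !inordK //=.
have -> : al = t * 2 + u by rewrite -tE; ring.
have -> : be = w * 2 + de by rewrite -wE; ring.
have -> : ga = u * nn - x * de by rewrite -uE; ring.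
by congr elt; ring.
Qed.

Hypotheses (dd_odd : ~~ (2 %| dd)%Z) (nx : (nn %| x ^+ 2 + 1)%Z)
  (m3 : (4 %| dd * nn + 1)%Z).

(** The auxiliary integers are the ingredients of the multiplication table: [g] and [f] are the
    norms of the third and fourth basis elements, [e] occurs in their mixed products. The quarters
    are integral because dd nn = 3 modulo 4. *)
Lemma order_OI : is_order OI.
Proof.
have [X xX] := dvdzP x_even; have [r rE] := dvdzP nx.
have [n nE] : exists n, nn = 2 * n + 1 by exists (nn %/ 2)%Z; lia.
have [d dE] : exists d, dd = 2 * d + 1 by exists (dd %/ 2)%Z; lia.
have [g gE] := dvdzP m3.
have [e eE] : exists e, dd + nn = 4 * e.
  exists (g - d * n); move: gE; rewrite dE nE => gE.
  have -> : 4 * (g - d * n) = g * 4 - 4 * (d * n) by ring.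
  by rewrite -gE; ring.
have [rho rhoE] : exists rho, r = 2 * rho + 1.
  exists (2 * X ^+ 2 - r * n).
  have -> : 2 * (2 * X ^+ 2 - r * n) + 1 = x ^+ 2 + 1 - 2 * (r * n).
    by rewrite xX; ring.
  by rewrite rE nE; ring.
have [f fE] : exists f, dd * r + 1 = 4 * f.
  exists (e * r - X ^+ 2); have -> : dd = 4 * e - nn by rewrite -eE; ring.
  have -> : (4 * e - nn) * r + 1 = 4 * (e * r) + 1 - r * nn by ring.
  by rewrite -rE xX; ring.
apply: order_of_basis.
- move=> v; rewrite sum_ord4 /basisI !inordK //= => /quatP.
  rewrite /elt !qE => -[e0 e1 e2 e3].
  have n20 : (2%:R * nn%:~R : rat) != 0 by rewrite mulf_neq0.
  have v3 : v (inord 3) = 0.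
    by apply: (mulIf (invr_neq0 n20)); rewrite [RHS]mul0r -[RHS]e3; ring.
  have v2 : v (inord 2) = 0.
    apply: (@mulIf _ 2%:R^-1) => //; rewrite [RHS]mul0r -[RHS]e2 v3.
    by field.
  apply: ord4_ind => //.
    by apply: (@mulIf _ 1) => //; rewrite [RHS]mul0r -[RHS]e0 v2 v3; field.
  by apply: (@mulIf _ 1) => //; rewrite [RHS]mul0r -[RHS]e1 v2 v3; field.
- exists (fun k : 'I_4 => [:: 1; 0; 0; 0]`_k); rewrite sum_basisI !inordK //=.
  by rewrite -el1; congr elt; ring.
have nR : n%:~R = (nn%:~R - 1) / 2%:R :> rat by rewrite nE; field.
have dR : d%:~R = (dd%:~R - 1) / 2%:R :> rat by rewrite dE; field.
have XR : X%:~R = x%:~R / 2%:R :> rat by rewrite xX; field.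
have rR : r%:~R = (x%:~R ^+ 2 + 1) / nn%:~R :> rat.
  apply: (mulIf nnR); rewrite divfK // -rmorphM -rE;
    by rewrite rmorphD rmorphXn.
have rhoR : rho%:~R = (r%:~R - 1) / 2%:R :> rat by rewrite rhoE; field.
have eR : e%:~R = (dd%:~R + nn%:~R) / 4%:R :> rat.
  by rewrite -rmorphD eE; field.
have fR : f%:~R = (dd%:~R * r%:~R + 1) / 4%:R :> rat.
  have -> : dd%:~R * r%:~R + 1 = (dd * r + 1)%:~R :> rat by rewrite rmorphD
    rmorphM.
  by rewrite fE; field.
have gR : g%:~R = (dd%:~R * nn%:~R + 1) / 4%:R :> rat.
  have -> : dd%:~R * nn%:~R + 1 = (dd * nn + 1)%:~R :> rat by rewrite rmorphD
    rmorphM.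
  by rewrite gE; field.
rewrite rR in rhoR fR.
have b0 : basisI (inord 0) = 1 by rewrite /basisI inordK // el1.
have prod i j (z0 z1 z2 z3 : int) : basisI i * basisI j =
    elt (2 * z0 + z2) (2 * z1 + z3) (nn * z2 - x * z3) z3 ->
    exists z : 'I_4 -> int, basisI i * basisI j = \sum_k (z k)%:~R *: basisI k.
  move=> ->; exists (fun k : 'I_4 => [:: z0; z1; z2; z3]`_k).
  by rewrite sum_basisI !inordK.
have idl i : exists z : 'I_4 -> int, basisI i = \sum_k (z k)%:~R *: basisI k.
  exists (fun k : 'I_4 => (i == k)%:Z); rewrite (bigD1 i) //= eqxx scale1r.
  by rewrite big1 ?addr0 // => k /negPf ki; rewrite eq_sym ki scale0r.
apply: ord4_ind => [j|||]; first by rewrite b0 mul1r.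
- apply: ord4_ind; first by rewrite b0 mulr1.
  + apply: (prod _ _ (-1) 0 0 0); rewrite /basisI !inordK //=.
    by apply/quatP; rewrite /elt !qE; split; field.
  + apply: (prod _ _ (- X) (- n) (2 * X) nn); rewrite /basisI !inordK //=.
    apply/quatP; rewrite /elt !qE !(rmorphN, rmorphB, rmorphD,
      rmorphM) /= nR XR.
    by split; field.
  + apply: (prod _ _ rho X (- r) (- (2 * X))); rewrite /basisI !inordK //=.
    apply/quatP; rewrite /elt !qE !(rmorphN, rmorphB, rmorphD,
      rmorphM) /= rhoR XR rR.
    by split; field.
- apply: ord4_ind; first by rewrite b0 mulr1.
  + apply: (prod _ _ X (n + 1) (- (2 * X)) (- nn)); rewrite /basisI !inordK //=.
    apply/quatP; rewrite /elt !qE !(rmorphN, rmorphB, rmorphD,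
      rmorphM) /= nR XR.
    by split; field.
  + apply: (prod _ _ (- g) 0 1 0); rewrite /basisI !inordK //=.
    apply/quatP; rewrite /elt !qE !(rmorphN, rmorphB, rmorphD, rmorphM) /= gR.
    by split; field.
  + apply: (prod _ _ (X * (d + 1)) e (- X) (- n)); rewrite /basisI !inordK //=.
    apply/quatP; rewrite /elt !qE !(rmorphN, rmorphB, rmorphD,
      rmorphM) /= dR eR XR nR.
    by split; field.
- apply: ord4_ind; first by rewrite b0 mulr1.
  + apply: (prod _ _ (- (rho + 1)) (- X) r (2 * X));
    rewrite /basisI !inordK //=.
    apply/quatP; rewrite /elt !qE !(rmorphN, rmorphB, rmorphD,
      rmorphM) /= rhoR XR rR.
    by split; field.
  + apply: (prod _ _ (X * d) (- e) X (n + 1)); rewrite /basisI !inordK //=.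
    apply/quatP; rewrite /elt !qE !(rmorphN, rmorphB, rmorphD,
      rmorphM) /= dR eR XR nR.
    by split; field.
  + apply: (prod _ _ (- f) 0 0 0); rewrite /basisI !inordK //=.
    apply/quatP; rewrite /elt !qE !(rmorphN, rmorphB, rmorphD, rmorphM) /= fR.
    by split; field.
Qed.

End TypeI.
Section TypeII.

(* The basis 1, i, j, (1 + i) / 2 + (k - x j) / (2 nn), for an odd x; the order
   it spans is maximal when dd nn = 1 mod 4. *)
Definition basisII (i : 'I_4) : A :=
  nth 0 [:: elt 2 0 0 0; elt 0 2 0 0; elt 0 0 (2 * nn) 0; elt 1 1 (- x) 1] i.

Lemma sum_basisII (z : 'I_4 -> int) : \sum_i (z i)%:~R *: basisII i =
  elt (2 * z (inord 0) + z (inord 3)) (2 * z (inord 1) + z (inord 3))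
     (2 * nn * z (inord 2) - x * z (inord 3)) (z (inord 3)).
Proof.
rewrite sum_ord4 /basisII !inordK //=; apply/quatP; rewrite /elt !qE.
by rewrite !(rmorphB, rmorphD, rmorphM, rmorphN) /=; split; ring.
Qed.

Definition OII : set A :=
  [set y | exists z : 'I_4 -> int, y = \sum_i (z i)%:~R *: basisII i]%classic.

Hypotheses (nn_odd : ~~ (2 %| nn)%Z) (x_odd : ~~ (2 %| x)%Z).

(** If ga = u nn - x de with nn and x odd, then ga = de modulo 2 exactly when u is even, and u / 2
    is the coefficient of j. *)
Lemma OII_el al be ga de : OII (elt al be ga de) <->
  [/\ (nn %| ga + x * de)%Z, (2 %| al - de)%Z, (2 %| be - de)%Z
    & (2 %| ga - de)%Z].
Proof.
have [X xX] : exists X, x = 2 * X + 1 by exists (x %/ 2)%Z; lia.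
have [n nE] : exists n, nn = 2 * n + 1 by exists (nn %/ 2)%Z; lia.
split=> [[z]|[/dvdzP[u uE] /dvdzP[t tE] /dvdzP[w wE] /dvdzP[s sE]]].
  rewrite sum_basisII => /el_inj[-> -> -> ->].
  split; apply/dvdzP.
  - by exists (2 * z (inord 2)); ring.
  - by exists (z (inord 0)); ring.
  - by exists (z (inord 1)); ring.
  - exists (nn * z (inord 2) - (X + 1) * z (inord 3)).
    by rewrite xX; ring.
have uE2 : u = 2 * (s + (X + 1) * de - n * u).
  have -> : 2 * (s + (X + 1) * de - n * u)
    = (s * 2) + de + x * de - u * (2 * n) by rewrite xX; ring.
  by rewrite -sE subrK uE nE; ring.
exists (fun k : 'I_4 => [:: t; w; s + (X + 1) * de - n * u; de]`_k).
rewrite sum_basisII !inordK //=.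
have -> : al = t * 2 + de by rewrite -tE; ring.
have -> : be = w * 2 + de by rewrite -wE; ring.
have -> : ga = u * nn - x * de by rewrite -uE; ring.
have -> : 2 * nn * (s + (X + 1) * de - n * u) = u * nn by rewrite [in RHS]uE2;
  ring.
by congr elt; ring.
Qed.

Hypotheses (dd_odd : ~~ (2 %| dd)%Z) (nx : (nn %| x ^+ 2 + 1)%Z).

(** For x odd, (x^2 + 1) / nn is twice an odd number [rho], so the norm f = (dd rho + 1) / 2 of the
    last basis element is an integer. *)
Lemma order_OII : is_order OII.
Proof.
have [X xX] : exists X, x = 2 * X + 1 by exists (x %/ 2)%Z; lia.
have [r rE] := dvdzP nx.
have [n nE] : exists n, nn = 2 * n + 1 by exists (nn %/ 2)%Z; lia.
have [d dE] : exists d, dd = 2 * d + 1 by exists (dd %/ 2)%Z; lia.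
have [e eE] : exists e, dd + nn = 2 * e.
  by exists (d + n + 1); rewrite dE nE; ring.
have [rho rhoE] : exists rho, r = 2 * rho.
  exists (2 * X ^+ 2 + 2 * X + 1 - r * n).
  have -> : 2 * (2 * X ^+ 2 + 2 * X + 1 - r * n) = x ^+ 2 + 1 - 2 * (r * n).
    by rewrite xX; ring.
  by rewrite rE nE; ring.
have [f fE] : exists f, dd * rho + 1 = 2 * f.
  exists (d * rho + X ^+ 2 + X + 1 - rho * n).
  have : 2 * (2 * X ^+ 2 + 2 * X + 1) = 2 * (rho * nn).
    by rewrite mulrA -rhoE -rE xX; ring.
  have two0 : (2 : int) != 0 by [].
  move=> /(mulfI two0) E.
  have -> : 2 * (d * rho + X ^+ 2 + X + 1 - rho * n) =
    2 * d * rho + (2 * X ^+ 2 + 2 * X + 1) + 1 - 2 * (rho * n) by ring.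
  by rewrite E dE nE; ring.
apply: order_of_basis.
- move=> v; rewrite sum_ord4 /basisII !inordK //= => /quatP.
  rewrite /elt !qE => -[e0 e1 e2 e3].
  have n20 : (2%:R * nn%:~R : rat) != 0 by rewrite mulf_neq0.
  have v3 : v (inord 3) = 0.
    by apply: (mulIf (invr_neq0 n20)); rewrite [RHS]mul0r -[RHS]e3; ring.
  have v2 : v (inord 2) = 0.
    apply: (@mulIf _ 1) => //; rewrite [RHS]mul0r -[RHS]e2 v3 rmorphM /=.
    by field.
  apply: ord4_ind => //.
    by apply: (@mulIf _ 1) => //; rewrite [RHS]mul0r -[RHS]e0 v2 v3; field.
  by apply: (@mulIf _ 1) => //; rewrite [RHS]mul0r -[RHS]e1 v2 v3; field.
- exists (fun k : 'I_4 => [:: 1; 0; 0; 0]`_k); rewrite sum_basisII !inordK //=.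
  by rewrite -el1; congr elt; ring.
have XR : X%:~R = (x%:~R - 1) / 2%:R :> rat by rewrite xX; field.
have rR : r%:~R = (x%:~R ^+ 2 + 1) / nn%:~R :> rat.
  apply: (mulIf nnR); rewrite divfK // -rmorphM -rE;
    by rewrite rmorphD rmorphXn.
have rhoR : rho%:~R = r%:~R / 2%:R :> rat by rewrite rhoE; field.
have eR : e%:~R = (dd%:~R + nn%:~R) / 2%:R :> rat.
  by rewrite -rmorphD eE; field.
have fR : f%:~R = (dd%:~R * rho%:~R + 1) / 2%:R :> rat.
  have -> : dd%:~R * rho%:~R + 1 = (dd * rho + 1)%:~R :> rat by rewrite rmorphD
    rmorphM.
  by rewrite fE; field.
rewrite rR in rhoR; rewrite rhoR in fR.
have b0 : basisII (inord 0) = 1 by rewrite /basisII inordK // el1.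
have prod i j (z0 z1 z2 z3 : int) : basisII i * basisII j =
    elt (2 * z0 + z3) (2 * z1 + z3) (2 * nn * z2 - x * z3) z3 ->
    exists z : 'I_4 -> int, basisII i * basisII j = \sum_k (z k)%:~R *: basisII
      k.
  move=> ->; exists (fun k : 'I_4 => [:: z0; z1; z2; z3]`_k).
  by rewrite sum_basisII !inordK.
have idl i : exists z : 'I_4 -> int, basisII i = \sum_k (z k)%:~R *: basisII k.
  exists (fun k : 'I_4 => (i == k)%:Z); rewrite (bigD1 i) //= eqxx scale1r.
  by rewrite big1 ?addr0 // => k /negPf ki; rewrite eq_sym ki scale0r.
apply: ord4_ind => [j|||]; first by rewrite b0 mul1r.
- apply: ord4_ind; first by rewrite b0 mulr1.
  + apply: (prod _ _ (-1) 0 0 0); rewrite /basisII !inordK //=.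
    by apply/quatP; rewrite /elt !qE; split; field.
  + apply: (prod _ _ (- nn) (- nn) x (2 * nn)); rewrite /basisII !inordK //=.
    apply/quatP; rewrite /elt !qE !(rmorphN, rmorphB, rmorphD, rmorphM) /=.
    by split; field.
  + apply: (prod _ _ X (X + 1) (- rho) (- x)); rewrite /basisII !inordK //=.
    apply/quatP; rewrite /elt !qE !(rmorphN, rmorphB, rmorphD,
      rmorphM) /= rhoR XR.
    by split; field.
- apply: ord4_ind; first by rewrite b0 mulr1.
  + apply: (prod _ _ nn nn (- x) (- (2 * nn))); rewrite /basisII !inordK //=.
    apply/quatP; rewrite /elt !qE !(rmorphN, rmorphB, rmorphD, rmorphM) /=.
    by split; field.
  + apply: (prod _ _ (- (dd * nn)) 0 0 0); rewrite /basisII !inordK //=.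
    apply/quatP; rewrite /elt !qE !(rmorphN, rmorphB, rmorphD, rmorphM) /=.
    by split; field.
  + apply: (prod _ _ (dd * X + e) e (- X) (- nn)); rewrite /basisII !inordK //=.
    apply/quatP; rewrite /elt !qE !(rmorphN, rmorphB, rmorphD,
      rmorphM) /= eR XR.
    by split; field.
- apply: ord4_ind; first by rewrite b0 mulr1.
  + apply: (prod _ _ (- (X + 1)) (- X) rho x); rewrite /basisII !inordK //=.
    apply/quatP; rewrite /elt !qE !(rmorphN, rmorphB, rmorphD,
      rmorphM) /= rhoR XR.
    by split; field.
  + apply: (prod _ _ (dd * X + e - nn) (- e) (X + 1) nn);
    rewrite /basisII !inordK //=.
    apply/quatP; rewrite /elt !qE !(rmorphN, rmorphB, rmorphD,
      rmorphM) /= eR XR.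
    by split; field.
  + apply: (prod _ _ (- f) 0 0 1); rewrite /basisII !inordK //=.
    apply/quatP; rewrite /elt !qE !(rmorphN, rmorphB, rmorphD, rmorphM) /= fR.
    by split; field.
Qed.

End TypeII.

End Lattices.

(** * Coordinates of an element of a larger order *)

Section Maximality.
Local Open Scope ring_scope.
Variables (dd nn x : int).
Hypotheses (nn0 : nn != 0) (dd0 : dd != 0).
Local Notation A := (quat (-1 : rat) ((- (dd * nn))%:~R : rat)).
Local Notation el := (elt dd nn).
Let nnR : (nn%:~R : rat) != 0. Proof. by rewrite intr_eq0. Qed.

Hypotheses (nx : (nn %| x ^+ 2 + 1)%Z) (cop : coprimez nn dd).
Hypothesis dd_sum_squares : forall C E : int,
  (dd %| C ^+ 2 + E ^+ 2)%Z -> (dd %| C)%Z /\ (dd %| E)%Z.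

Lemma trd_el (y : A) al be ga de : trd (y * el al be ga de) =
  qc 0 y * al%:~R - qc 1 y * be%:~R
    - dd%:~R * (qc 2 y * ga%:~R + qc 3 y * de%:~R).
Proof.
by rewrite /trd /el !qE rmorphN rmorphM; field.
Qed.

Lemma nrd_qalg (y : A) : nrd y = qc 0 y ^+ 2 + qc 1 y ^+ 2
  + dd%:~R * nn%:~R * (qc 2 y ^+ 2 + qc 3 y ^+ 2).
Proof. by rewrite /nrd rmorphN rmorphM /=; ring. Qed.

(** The four given elements are i, j, k and (k - x j) / nn. Traces against 1, i, j, k bound the
    denominators of [y] by 2 and 2 dd nn; the integral norm makes dd divide C^2 + E^2, so dd
    cancels; the trace against the last element gives the congruence modulo nn. *)
Lemma order_el O' y : is_order O' -> O' (el 0 2 0 0) ->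
  O' (el 0 0 (2 * nn) 0) ->
  O' (el 0 0 0 (2 * nn)) -> O' (el 0 0 (- (2 * x)) 2) -> O' y ->
  exists al be ga de n : int, [/\ y = el al be ga de, (nn %| ga + x * de)%Z
    & nn * (al ^+ 2 + be ^+ 2) + dd * (ga ^+ 2 + de ^+ 2) = 4 * n * nn].
Proof.
move=> oO' Oi Oj Ok Oh Oy; have [_ _ OM _] := oO'.
have ddR : (dd%:~R : rat) != 0 by rewrite intr_eq0.
have [al alE] := order_trd oO' Oy.
have [be beE] := order_trd oO' (OM _ _ Oy Oi).
have [C CE] := order_trd oO' (OM _ _ Oy Oj).
have [E EE] := order_trd oO' (OM _ _ Oy Ok).
have [h hE] := order_trd oO' (OM _ _ Oy Oh).
have [n nE] := order_nrd oO' Oy.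
rewrite trd_el in beE; rewrite trd_el in CE; rewrite trd_el in EE.
rewrite trd_el in hE; rewrite /trd in alE; rewrite nrd_qalg in nE.
have y0 : qc 0 y = al%:~R / 2%:R by rewrite -alE; field.
have y1 : qc 1 y = - be%:~R / 2%:R by rewrite -beE; field.
have y2 : qc 2 y = - C%:~R / (2%:R * dd%:~R * nn%:~R).
  by rewrite -CE; field; rewrite nnR.
have y3 : qc 3 y = - E%:~R / (2%:R * dd%:~R * nn%:~R).
  by rewrite -EE; field; rewrite nnR.
have normE : dd * nn * (al ^+ 2 + be ^+ 2) + (C ^+ 2 + E ^+ 2) = 4 * n * (dd *
  nn).
  apply: (@intr_inj rat).
  rewrite !(rmorphD, rmorphM, rmorphXn) /= -nE y0 y1 y2 y3.
  by field; rewrite nnR.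
have [/dvdzP[ga gaE] /dvdzP[de deE]] : (dd %| C)%Z /\ (dd %| E)%Z.
  apply: dd_sum_squares; apply/dvdzP;
    exists (4 * n * nn - nn * (al ^+ 2 + be ^+ 2)).
  rewrite -[LHS](addKr (dd * nn * (al ^+ 2 + be ^+ 2))) normE; ring.
exists al, (- be), (- ga), (- de), n; split.
- apply/quatP; rewrite /el !qE y0 y1 y2 y3 gaE deE !(rmorphN, rmorphM) /=.
  by split; field; rewrite ?nnR.
- have hz : - h * nn = dd * (x * ga - de).
    apply: (@intr_inj rat); rewrite !(rmorphM, rmorphB,
      rmorphN) /= -hE y2 y3 gaE deE.
    by rewrite !rmorphM /=; field; rewrite nnR.
  have nd : (nn %| x * ga - de)%Z.
    by rewrite -(Gauss_dvdzr _ cop) -hz dvdz_mull.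
  have -> : - ga + x * - de = x * (x * ga - de) - ga * (x ^+ 2 + 1) by ring.
  by rewrite rpredB // dvdz_mull.
apply: (mulfI dd0); move: normE; rewrite gaE deE.
have -> : dd * (4 * n * nn) = 4 * n * (dd * nn) by ring.
by move=> <-; ring.
Qed.


End Maximality.

(** Squares are 0 or 1 modulo 4, so four of them add up to a multiple of 4 only when all are even or
    all are odd. *)
Lemma four_squares_parity (A B C E : int) :
  (4 %| (A ^+ 2 + B ^+ 2 + C ^+ 2 + E ^+ 2)%R)%Z ->
  [/\ (2 %| (A - E)%R)%Z, (2 %| (B - E)%R)%Z & (2 %| (C - E)%R)%Z].
Proof.
have sq4 (z : int) : exists u e a : int, [/\ z = 2 * u + e,
  e = 0 \/ e = 1 & z ^+ 2 = 4 * a + e]%R.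
  case: (boolP (2 %| z)%Z) => [/dvdzP[u ->]|z_odd].
    by exists u, 0%R, (u ^+ 2)%R; split; [ring | left | ring].
  have [u ->] : exists u, z = (2 * u + 1)%R by exists (z %/ 2)%Z; lia.
  by exists u, 1%R, (u ^+ 2 + u)%R; split; [ring | right | ring].
have [uA [eA [aA [-> hA ->]]]] := sq4 A; have [uB [eB [aB [-> hB ->]]]] :=
  sq4 B.
have [uC [eC [aC [-> hC ->]]]] := sq4 C; have [uE [eE [aE [-> hE ->]]]] :=
  sq4 E.
clear -hA hB hC hE; by case: hA hB hC hE => -> [] -> [] -> [] -> S; split; lia.
Qed.

(** * Maximality of the two lattices and intersections with a conjugate *)

Section EichlerOrders.
Local Open Scope ring_scope.

(** The conjugate order is again maximal, and the intersection is stable under [tau], so its index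
    is the same in both orders. *)
Lemma eichler_involution (a b : rat) (tau : quat a b -> quat a b)
    (O : set (quat a b)) N :
  (forall x, tau (tau x) = x) -> (forall x y, tau (x + y) = tau x + tau y) ->
  (forall c x, tau (c *: x) = c *: tau x) ->
  (forall x y, tau (x * y) = tau x * tau y) -> maximal_order O ->
  has_index O (O `&` [set y | O (tau y)])%classic N ->
  eichler_order (O `&` [set y | O (tau y)])%classic N.
Proof.
move=> tauK tauD tauZ tauM mO ind.
exists O, [set y | O (tau y)]%classic; split=> //.
  exact: maximal_involution.
apply: has_index_involution => // y /=.
by rewrite tauK; split=> -[].
Qed.

Variables (dd : int) (N0 : nat).
Local Notation nn := (Posz N0).
Local Notation b := ((- (dd * nn))%:~R : rat).
Local Notation A := (quat (-1 : rat) b).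
Local Notation el := (elt dd nn).

(* Conjugation by j, and by (1 + i) j. *)
Definition flip (y : A) : A := mkq _ _ (qc 0 y) (- qc 1 y) (qc 2 y) (- qc 3 y).
Definition swap (y : A) : A := mkq _ _ (qc 0 y) (- qc 1 y) (qc 3 y) (qc 2 y).

Lemma flip_el al be ga de : flip (el al be ga de) = el al (- be) ga (- de).
Proof. by apply/quatP; rewrite /flip /elt !qE !rmorphN !mulNr. Qed.

Lemma swap_el al be ga de : swap (el al be ga de) = el al (- be) de ga.
Proof. by apply/quatP; rewrite /swap /elt !qE !rmorphN !mulNr. Qed.

Lemma flipK y : flip (flip y) = y.
Proof. by apply/quatP; rewrite /flip !qE !opprK. Qed.
Lemma flipD x y : flip (x + y) = flip x + flip y.
Proof. by apply/quatP; rewrite /flip !qE; split; ring. Qed.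
Lemma flipZ c y : flip (c *: y) = c *: flip y.
Proof. by apply/quatP; rewrite /flip !qE; split; ring. Qed.
Lemma flipM x y : flip (x * y) = flip x * flip y.
Proof. by apply/quatP; rewrite /flip !qE; split; ring. Qed.

Lemma swapK y : swap (swap y) = y.
Proof. by apply/quatP; rewrite /swap !qE !opprK. Qed.
Lemma swapD x y : swap (x + y) = swap x + swap y.
Proof. by apply/quatP; rewrite /swap !qE; split; ring. Qed.
Lemma swapZ c y : swap (c *: y) = c *: swap y.
Proof. by apply/quatP; rewrite /swap !qE; split; ring. Qed.
Lemma swapM x y : swap (x * y) = swap x * swap y.
Proof. by apply/quatP; rewrite /swap !qE; split; ring. Qed.

Hypotheses (nn_odd : ~~ (2 %| nn)%Z) (dd_odd : ~~ (2 %| dd)%Z).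
Hypotheses (cop : coprimez nn dd).
Hypothesis dd_sum_squares : forall C E : int,
  (dd %| C ^+ 2 + E ^+ 2)%Z -> (dd %| C)%Z /\ (dd %| E)%Z.

Let nn0 : nn != 0. Proof. by apply: contraNneq nn_odd => ->. Qed.
Let dd0 : dd != 0. Proof. by apply: contraNneq dd_odd => ->. Qed.
Let N0_gt0 : (0 < N0)%N. Proof. by rewrite lt0n; exact: nn0. Qed.

Section TypeI.
Variable x : int.
Hypotheses (x_even : (2 %| x)%Z) (nx : (nn %| x ^+ 2 + 1)%Z)
  (m3 : (4 %| dd * nn + 1)%Z).
Local Notation OI := (@OI dd nn x).
Local Notation OI_el := (@OI_el dd nn x nn0 nn_odd x_even).

(** [order_el] leaves only the two parities, which come from the traces against (1 + j) / 2 and (i +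
    k) / 2, both in the lattice; dd odd replaces dd by 1 modulo 2. *)
Lemma maximal_OI : maximal_order OI.
Proof.
have oOI := order_OI nn0 nn_odd x_even dd_odd nx m3.
split=> // O' oO' sub; apply/seteqP; split=> // y Oy.
have OE al be ga de : [/\ (nn %| ga + x * de)%Z,
  (2 %| al - ga)%Z & (2 %| be - de)%Z] ->
    O' (el al be ga de) by move=> /OI_el/sub.
have [d dE] : exists d, dd = 2 * d + 1 by clear -dd_odd; exists (dd %/ 2)%Z;
  lia.
have [||||al [be [ga [de [n [yE ngd _]]]]]] :=
  order_el nn0 dd0 nx cop dd_sum_squares oO' _ _ _ _ Oy.
- by apply: OE; rewrite !subr0 mulr0 addr0 dvdz0.
- apply: OE; split; rewrite ?mulr0 ?addr0 ?sub0r ?rpredN ?dvdz0 //.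
    by rewrite dvdz_mull.
  by rewrite dvdz_mulr.
- apply: OE; split; rewrite ?add0r ?sub0r ?rpredN ?dvdz0 //.
    by rewrite !dvdz_mull.
  by rewrite dvdz_mulr.
- apply: OE; rewrite !sub0r !rpredN dvdz_mulr // dvdzz; split=> //.
  by rewrite [x * 2]mulrC addNr dvdz0.
rewrite yE; apply/OI_el; split=> //.
  have O3 : O' (el 1 0 nn 0).
    by apply: OE; rewrite mulr0 addr0 dvdzz subr0 dvdz0; split=> //;
      clear -nn_odd; lia.
  have [_ _ OM _] := oO'; have [h] := order_trd oO' (OM _ _ Oy O3).
  rewrite trd_el // yE /elt !qE => hE; apply/dvdzP; exists (h + d * ga).
  apply: (@intr_inj rat); rewrite rmorphB !rmorphM rmorphD rmorphM /= -hE dE.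
  by field; rewrite pnatr_eq0 -lt0n.
have O4 : O' (el 0 1 0 nn).
  by apply: OE; rewrite add0r dvdz_mull // subr0 dvdz0; split=> //;
    clear -nn_odd; lia.
have [_ _ OM _] := oO'; have [h] := order_trd oO' (OM _ _ Oy O4).
rewrite trd_el // yE /elt !qE => hE; apply/dvdzP; exists (- h - (d + 1) * de).
apply: (@intr_inj rat); rewrite !(rmorphB, rmorphM, rmorphD, rmorphN) /= -hE dE.
by field; rewrite pnatr_eq0 -lt0n.
Qed.

Lemma OI_el_exists y : OI y -> exists al be ga de, y = el al be ga de.
Proof. by move=> [z ->]; rewrite sum_basisI; do 4!eexists. Qed.

(** The quotient is generated by i / 2 + (k - x j) / (2 nn), and the class of an element is its last
    coordinate [de] modulo nn. *)
Lemma eichler_OI_flip :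
  eichler_order (OI `&` [set y | OI (flip y)])%classic N0.
Proof.
have [oOI _] := maximal_OI.
apply: (eichler_involution flipK flipD flipZ flipM maximal_OI).
apply: (@has_index_cyclic _ _ _ _ _ (el 0 1 (- x) 1)) => //.
- by split=> /=; [|have -> : flip 0 = 0 by apply/quatP;
  rewrite /flip !qE !oppr0];
    apply: order0.
- by apply/OI_el; rewrite mulr1 addNr dvdz0 sub0r opprK x_even subrr dvdz0.
move=> y Oy; have [al [be [ga [de yE]]]] := OI_el_exists Oy.
move: Oy; rewrite {}yE => /OI_el[n1 p1 p2]; exists de => k.
have [X xX] := dvdzP x_even.
rewrite elZ elB /= flip_el !mulr0 !mulr1 subr0 mulrN opprK.
split=> [[_ /OI_el[n2 _ _]]|kd].
  (* Difference of the congruences for [y] and for the flipped remainder; 2 and x are invertible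
     modulo nn. *)
  have : (nn %| 2 * (x * (de - k)))%Z.
    have -> : 2 * (x * (de - k)) = (ga + x * de) - (ga + k * x + x * - (de -
      k)) by ring.
    by rewrite rpredB.
  rewrite Gauss_dvdzr; last first.
    by rewrite coprimezE /= coprime_sym prime_coprime.
  have nxc : coprimez nn x.
    apply/coprimezP; have [r rE] := dvdzP nx; exists (r, - x) => /=.
    by rewrite -rE; ring.
  by rewrite Gauss_dvdzr.
split; apply/OI_el; split.
- have -> : ga + k * x + x * (de - k) = ga + x * de by ring.
  by [].
- have -> : al - (ga + k * x) = (al - ga) - k * X * 2 by rewrite xX; ring.
  by rewrite rpredB // dvdz_mull.
- have -> : be - k - (de - k) = be - de by ring.
  by [].
- have -> : ga + k * x + x * - (de - k) = (ga + x * de) - (2 * x) * (de - k) by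
  ring.
  by rewrite rpredB // dvdz_mull.
- have -> : al - (ga + k * x) = (al - ga) - k * X * 2 by rewrite xX; ring.
  by rewrite rpredB // dvdz_mull.
have -> : - (be - k) - - (de - k) = - (be - de) by ring.
by rewrite rpredN.
Qed.

(** Exchanging the coordinates turns the parity condition between [al] and [ga] into one between
    [al] and [de]; this independent condition contributes the factor 2. *)
Lemma eichler_OI_swap :
  eichler_order (OI `&` [set y | OI (swap y)])%classic (2 * N0).
Proof.
have [oOI _] := maximal_OI.
apply: (eichler_involution swapK swapD swapZ swapM maximal_OI).
apply: (@has_index_cyclic _ _ _ _ _ (el 0 1 (- x) 1)) => //.
- by rewrite muln_gt0.
- by split=> /=; [|have -> : swap 0 = 0 by apply/quatP;
  rewrite /swap !qE !oppr0];
    apply: order0.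
- by apply/OI_el; rewrite mulr1 addNr dvdz0 sub0r opprK x_even subrr dvdz0.
move=> y Oy; have [al [be [ga [de yE]]]] := OI_el_exists Oy.
(* A Chinese remainder: de modulo nn, and de + al modulo 2 since nn is odd. *)
move: Oy; rewrite {}yE => /OI_el[n1 p1 p2]; exists (de + nn * al) => k.
have [X xX] := dvdzP x_even; have [r rE] := dvdzP nx.
have [n nE] : exists n, nn = 2 * n + 1 by clear -nn_odd; exists (nn %/ 2)%Z;
  lia.
have cop2 : coprimez 2 nn by rewrite coprimezE /= prime_coprime.
rewrite elZ elB /= swap_el !mulr0 !mulr1 subr0 mulrN opprK.
rewrite PoszM Gauss_dvdz //.
have -> : (2 %| de + nn * al - k)%Z = (2 %| al - (de - k))%Z.
  apply/idP/idP => kd.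
    have -> : al - (de - k) = (de + nn * al - k) - 2 * (de + n * al - k).
      by rewrite nE; ring.
    by rewrite rpredB // dvdz_mulr.
  have -> : de + nn * al - k = (al - (de - k)) + 2 * (de + n * al - k).
    by rewrite nE; ring.
  by rewrite rpredD // dvdz_mulr.
have -> : (nn %| de + nn * al - k)%Z = (nn %| de - k)%Z.
  apply/idP/idP => kd.
    have -> : de - k = (de + nn * al - k) - nn * al by ring.
    by rewrite rpredB // dvdz_mulr.
  have -> : de + nn * al - k = (de - k) + nn * al by ring.
  by rewrite rpredD // dvdz_mulr.
split=> [[_ /OI_el[n2 p3 _]]|/andP[p3 kd]].
  apply/andP; split=> //.
  (* Both congruences are combined using x^2 = -1 modulo nn. *)
  have : (nn %| 2 * (de - k))%Z.
    have -> : 2 * (de - k) = (de - k + x * (ga + k * x)) - x * (ga + x * de)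
        + (x ^+ 2 + 1) * (de - k) by ring.
    by rewrite rpredD ?rpredB //; [apply: dvdz_mull | apply: dvdz_mulr].
  by rewrite Gauss_dvdzr // coprimez_sym.
split; apply/OI_el; split.
- have -> : ga + k * x + x * (de - k) = ga + x * de by ring.
  by [].
- have -> : al - (ga + k * x) = (al - ga) - k * X * 2 by rewrite xX; ring.
  by rewrite rpredB // dvdz_mull.
- have -> : be - k - (de - k) = be - de by ring.
  by [].
- have -> : de - k + x * (ga + k * x) = 2 * (de - k) + x * (ga + x * de)
      - (x ^+ 2 + 1) * (de - k) by ring.
  by rewrite rpredB ?rpredD // dvdz_mull.
- by [].
have -> : - (be - k) - (ga + k * x) = (al - ga) - (al - (de - k)) - (be - de)
    + 2 * (k - de - X * k) by rewrite xX; ring.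
rewrite rpredD //; last exact: dvdz_mulr.
by rewrite rpredB // rpredB.
Qed.

(** These are the integer combinations of i, j, k, a set stable under [flip] and [swap]; the square
    roots of -1 and -m will be taken there. *)
Lemma OI_pure k g d : OI (el 0 (2 * k) (2 * nn * g) (2 * nn * d)).
Proof.
have nn2 (l : int) : (nn %| 2 * nn * l)%Z by rewrite dvdz_mulr // dvdz_mull.
have two2 (l : int) : (2 %| 2 * nn * l)%Z by rewrite -mulrA dvdz_mulr.
apply/OI_el; split; first by rewrite rpredD // dvdz_mull.
  by rewrite sub0r rpredN.
by rewrite rpredB // dvdz_mulr.
Qed.

Lemma OI_flip_pure k g d :
  (OI `&` [set y | OI (flip y)])%classic (el 0 (2 * k) (2 * nn * g) (2 * nn *
    d)).
Proof. by split; rewrite /= ?flip_el -?mulrN; apply: OI_pure. Qed.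

Lemma OI_swap_pure k g d :
  (OI `&` [set y | OI (swap y)])%classic (el 0 (2 * k) (2 * nn * g) (2 * nn *
    d)).
Proof. by split; rewrite /= ?swap_el -?mulrN; apply: OI_pure. Qed.

End TypeI.

Section TypeII.
Variable x : int.
Hypotheses (x_odd : ~~ (2 %| x)%Z) (nx : (nn %| x ^+ 2 + 1)%Z)
  (m1 : (4 %| dd * nn - 1)%Z).
Local Notation OII := (@OII dd nn x).
Local Notation OII_el := (@OII_el dd nn x nn0 nn_odd x_odd).

Lemma OII_pure k g d : OII (el 0 (2 * k) (2 * nn * g) (2 * nn * d)).
Proof.
have nn2 (l : int) : (nn %| 2 * nn * l)%Z by rewrite dvdz_mulr // dvdz_mull.
have two2 (l : int) : (2 %| 2 * nn * l)%Z by rewrite -mulrA dvdz_mulr.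
apply/OII_el; split; first by rewrite rpredD // dvdz_mull.
- by rewrite sub0r rpredN.
- by rewrite rpredB // dvdz_mulr.
by rewrite rpredB.
Qed.

Lemma OII_flip_pure k g d :
  (OII `&` [set y | OII (flip y)])%classic (el 0 (2 * k) (2 * nn * g) (2 * nn *
    d)).
Proof. by split; rewrite /= ?flip_el -?mulrN; apply: OII_pure. Qed.

(** Here dd = nn modulo 4, so the integral norm makes nn times a sum of four squares divisible by 4,
    and the coordinates all have the same parity. *)
Lemma maximal_OII : maximal_order OII.
Proof.
have oO := order_OII nn0 nn_odd x_odd dd_odd nx.
split=> // O' oO' sub; apply/seteqP; split=> // y Oy.
have [X xX] : exists X, x = 2 * X + 1 by clear -x_odd; exists (x %/ 2)%Z; lia.
have O'i : O' (el 0 2 0 0) by apply: sub; have := OII_pure 1 0 0;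
  rewrite !mulr0 mulr1.
have O'j : O' (el 0 0 (2 * nn) 0).
  by apply: sub; have := OII_pure 0 1 0; rewrite mulr1 !mulr0.
have O'k : O' (el 0 0 0 (2 * nn)).
  by apply: sub; have := OII_pure 0 0 1; rewrite mulr1 !mulr0.
have O'h : O' (el 0 0 (- (2 * x)) 2).
  apply: sub; apply/OII_el; split; rewrite ?sub0r ?rpredN ?dvdzz //.
    by rewrite [x * 2]mulrC addNr dvdz0.
  have -> : - (2 * x) - 2 = 2 * (- x - 1) by ring.
  by rewrite dvdz_mulr.
have [al [be [ga [de [n [yE ngd normE]]]]]] :=
  order_el nn0 dd0 nx cop dd_sum_squares oO' O'i O'j O'k O'h Oy.
rewrite yE; apply/OII_el.
have [e eE] : exists e, dd = nn + 4 * e.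
  have [u nE] : exists n, nn = 2 * n + 1 by clear -nn_odd; exists (nn %/ 2)%Z;
    lia.
  have [d dE] : exists d, dd = 2 * d + 1 by clear -dd_odd; exists (dd %/ 2)%Z;
    lia.
  have [q qE] := dvdzP m1; exists (q - d * u - u).
  have -> : 4 * (q - d * u - u) = q * 4 - 4 * (d * u + u) by ring.
  by rewrite -qE dE nE; ring.
have [|p1 p2 p3] := @four_squares_parity al be ga de; last by split.
have : (4 %| nn * (al ^+ 2 + be ^+ 2 + ga ^+ 2 + de ^+ 2))%Z.
  have -> : nn * (al ^+ 2 + be ^+ 2 + ga ^+ 2 + de ^+ 2) =
      nn * (al ^+ 2 + be ^+ 2) + dd * (ga ^+ 2 + de ^+ 2)
      - 4 * (e * (ga ^+ 2 + de ^+ 2)) by rewrite eE; ring.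
  by rewrite normE -!mulrA -mulrBr dvdz_mulr.
rewrite Gauss_dvdzr // coprimezE /=.
by rewrite (@coprime_pexpl 2 2) // prime_coprime.
Qed.

(** The quotient is generated by (1 + i) / 2 + (k - x j) / (2 nn), with class again given by [de]
    modulo nn. *)
Lemma eichler_OII_flip :
  eichler_order (OII `&` [set y | OII (flip y)])%classic N0.
Proof.
have [oO _] := maximal_OII.
apply: (eichler_involution flipK flipD flipZ flipM maximal_OII).
apply: (@has_index_cyclic _ _ _ _ _ (el 1 1 (- x) 1)) => //.
- by split=> /=; [|have -> : flip 0 = 0 by apply/quatP;
  rewrite /flip !qE !oppr0];
    apply: order0.
- apply/OII_el; rewrite mulr1 addNr dvdz0 subrr dvdz0; split=> //.
  by clear -x_odd; lia.
move=> y Oy; have [al [be [ga [de yE]]]] : exists al be ga de,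
  y = el al be ga de.
  by case: Oy => z ->; rewrite sum_basisII; do 4!eexists.
move: Oy; rewrite {}yE => /OII_el[n1 p1 p2 p3]; exists de => k.
have [X xX] : exists X, x = 2 * X + 1 by clear -x_odd; exists (x %/ 2)%Z; lia.
rewrite elZ elB /= flip_el !mulr1 mulrN opprK.
split=> [[_ /OII_el[n2 _ _ _]]|kd].
  have : (nn %| 2 * (x * (de - k)))%Z.
    have -> : 2 * (x * (de - k)) = (ga + x * de) - (ga + k * x + x * - (de -
      k)) by ring.
    by rewrite rpredB.
  rewrite Gauss_dvdzr; last first.
    by rewrite coprimezE /= coprime_sym prime_coprime.
  have nxc : coprimez nn x.
    apply/coprimezP; have [r rE] := dvdzP nx; exists (r, - x) => /=.
    by rewrite -rE; ring.
  by rewrite Gauss_dvdzr.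
have gax : ga + k * x - (de - k) = (ga - de) + 2 * (k * (X + 1)) by rewrite xX;
  ring.
split; apply/OII_el; split.
- have -> : ga + k * x + x * (de - k) = ga + x * de by ring.
  by [].
- have -> : al - k - (de - k) = al - de by ring.
  by [].
- have -> : be - k - (de - k) = be - de by ring.
  by [].
- by rewrite gax rpredD // dvdz_mulr.
- have -> : ga + k * x + x * - (de - k) = (ga + x * de) - (2 * x) * (de - k) by
  ring.
  by rewrite rpredB // dvdz_mull.
- have -> : al - k - - (de - k) = (al - de) + 2 * (de - k) by ring.
  by rewrite rpredD // dvdz_mulr.
- have -> : - (be - k) - - (de - k) = - (be - de) by ring.
  by rewrite rpredN.
have -> : ga + k * x - - (de - k) = ga + k * x - (de - k) + 2 * (de - k) by
  ring.
by rewrite gax rpredD ?dvdz_mulr // rpredD // dvdz_mulr.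
Qed.

End TypeII.

End EichlerOrders.

(** * The algebra (-1, -d n): ramification and the embedded pair *)

Section Sufficiency.
Local Open Scope ring_scope.
Variables (d n : nat).
Local Notation c := (- (Posz d * Posz n)).
Local Notation B := (quat (-1 : rat) (c%:~R : rat)).
Local Notation el := (elt (Posz d) (Posz n)).

Hypotheses (d_odd : odd d) (n_odd : odd n) (sqd : squarefree d) (sqn :
  squarefree n).
Hypothesis copdn : coprime d n.
Hypothesis d3 : forall p, p \in primes d -> p = 3 %[mod 4].
Hypothesis n1 : forall p, p \in primes n -> p = 1 %[mod 4].

Let d0 : (0 < d)%N. Proof. by case: d d_odd. Qed.
Let n0 : (0 < n)%N. Proof. by case: n n_odd. Qed.

Let c_lt0 : c < 0.
Proof. by rewrite oppr_lt0 -PoszM ltz_nat muln_gt0 d0. Qed.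

(** The elements [i0], [j0], [l0] are i, j and j - k, left unsimplified so as to match the pure
    elements known to lie in the Eichler orders. *)
Let i0 : B := el 0 (2 * 1) (2 * Posz n * 0) (2 * Posz n * 0).
Let j0 : B := el 0 (2 * 0) (2 * Posz n * 1) (2 * Posz n * 0).
Let l0 : B := el 0 (2 * 0) (2 * Posz n * 1) (2 * Posz n * (-1)).

Let ii : i0 * i0 = -1.
Proof. by apply/quatP; rewrite /i0 /elt !qE !rmorphM; split; field;
  rewrite pnatr_eq0 -lt0n. Qed.

Let jj : j0 * j0 = c%:~R%:A.
Proof.
by apply/quatP; rewrite /j0 /elt !qE !rmorphM; split; field;
  rewrite pnatr_eq0 -lt0n.
Qed.

Let ll : l0 * l0 = (2 * c)%:~R%:A.
Proof.
by apply/quatP; rewrite /l0 /elt !qE !rmorphM; split; field;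
  rewrite pnatr_eq0 -lt0n.
Qed.

Let ji : j0 * i0 = - (i0 * j0).
Proof.
by apply/quatP; rewrite /i0 /j0 /elt !qE !rmorphM; split; field;
  rewrite pnatr_eq0 -lt0n.
Qed.

Let c_neq0 : c != 0. Proof. by rewrite lt_eqF. Qed.

(** For p dividing d, p divides d n exactly once and -1 is not a square; for p dividing n, -1 is a
    square; at any other odd p, d n is a unit. At 2 the residue of d n modulo 4 decides. *)
Lemma pair_ramifiedP p : prime p ->
  ramified_at (-1) c%:~R p <-> (p %| d)%N \/ (p = 2%N /\ (4 %| Posz d * Posz n
    - 1)%Z).
Proof.
move=> pp; have ram := ramified_atP c_neq0 ii jj ji p.
have dn_odd : ~~ (2 %| Posz d * Posz n)%Z by rewrite -PoszM dvdzE /= dvdn2 oddM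
  d_odd n_odd.
have [p2|p_odd] := even_prime pp.
  have pd : ~~ (p %| d)%N by rewrite p2 dvdn2 d_odd.
  split=> [/ram[pp' dp]|[pd'|[_ m1]]]; last 1 first.
  - by apply/ram; exists pp; apply: dyadic_division.
  - right; split=> //; apply: contraT => m1.
    have m3 : (4 %| c - 1)%Z by clear -dn_odd m1; lia.
    by case: (dyadic_not_division p2 m3 dp).
  - by rewrite pd' in pd.
split=> [/ram[pp' dp]|[pd|[p2 _]]]; last 2 first.
- have p3 : p = 3 %[mod 4] by apply: d3; rewrite mem_primes pp d0.
  apply/ram; exists pp; have [u dE] := dvdnP pd.
  have -> : Posz d * Posz n = Posz p * (Posz u * Posz n) by rewrite dE PoszM;
    ring.
  apply: odd_division => //; rewrite -PoszM dvdzE /= Euclid_dvdM // negb_or.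
  apply/andP; split.
    apply/negP => /dvdnP[w uE]; have := sqd pp.
    by rewrite dE uE -mulnA mulnn dvdn_mull.
  apply/negP => pn; have := dvdn_gcd p d n; rewrite pd pn (eqP copdn) dvdn1.
  by move=> /eqP p1; rewrite p1 in pp.
- by rewrite p2 in p_odd.
left; apply: contraT => pd.
have [pn|pn] := boolP (p %| n)%N.
  have p1 : p = 1 %[mod 4] by apply: n1; rewrite mem_primes pp n0.
  by case: (sqrt_not_division p1 dp).
have pc : ~~ (p %| c)%Z by rewrite rpredN -PoszM dvdzE /= Euclid_dvdM //
  negb_or pd.
by case: (unit_not_division p_odd pc dp).
Qed.

Lemma dvd_sum_squares (C E : int) :
  (Posz d %| C ^+ 2 + E ^+ 2)%Z -> (Posz d %| C)%Z /\ (Posz d %| E)%Z.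
Proof.
move=> dCE; suff H p : prime p -> (p %| d)%N -> (p %| C)%Z && (p %| E)%Z.
  by split; rewrite dvdzE; apply: squarefree_dvd => // p pp pd; have /andP[] :=
    H p pp pd.
move=> pp pd; apply: sum_squares_dvd => //.
- have [p2|//] := even_prime pp; move: pd; rewrite p2 dvdn2 d_odd //.
- by apply: d3; rewrite mem_primes pp d0.
by apply: dvdz_trans dCE; rewrite dvdzE.
Qed.

(** Adding the odd number n to a root changes its parity; the two lattices call for opposite
    parities. *)
Lemma exists_sqrt_minus1 (par : bool) : exists x : int,
  (Posz n %| x ^+ 2 + 1)%Z /\ (2 %| x)%Z = par.
Proof.
have [|x xP] := @sqrt_minus1_prod _ (primes_uniq n).
  by move=> p pn; split; [move: pn; rewrite mem_primes => /and3P[] | apply: n1].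
rewrite -squarefree_prod_primes // in xP.
have [<-|x_par] := eqVneq (2 %| x)%Z par; first by exists x.
exists (x + Posz n); split.
  have -> : (x + Posz n) ^+ 2 + 1 = (x ^+ 2 + 1) + Posz n * (2 * x + Posz n) by
    ring.
  by rewrite rpredD // dvdz_mulr.
have : ~~ (2 %| Posz n)%Z by rewrite dvdzE /= dvdn2 n_odd.
by case: par x_par; clear; case: (boolP (2 %| x)%Z) => // ? _ ?; apply/idP; lia.
Qed.

(** Every prime of n contributes 1 and every prime of d contributes -1 modulo 4. *)
Lemma mod4_prod :
  (d * n = (if odd (size (primes d)) then 3 else 1) %[mod 4])%N.
Proof.
rewrite -modnMm {1}(squarefree_prod_primes d0 sqd) (prod_mod4_3 d3).
rewrite {1}(squarefree_prod_primes n0 sqn) (prod_mod4_1 n1).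
by case: (odd _).
Qed.

Lemma pair_discriminant (D : nat) : (0 < D)%N -> squarefree D ->
  (forall p, prime p ->
    (p %| D)%N <-> (p %| d)%N \/ (p = 2%N /\ (4 %| Posz d * Posz n - 1)%Z)) ->
  has_discriminant (-1) c%:~R D.
Proof.
move=> D0 sqD DP; exists (primes D); split; first exact: primes_uniq.
  move=> p; rewrite mem_primes D0 /=; split=> [/andP[pp /(DP p pp)]|].
    by move/(pair_ramifiedP pp).
  move=> ram; have [pp _] := ram; rewrite pp /=.
  by apply/(DP p pp)/(pair_ramifiedP pp).
exact: squarefree_prod_primes.
Qed.

Lemma pair_construction (D N m : nat) (O : set B) :
  has_discriminant (-1) c%:~R D ->
  eichler_order O N ->
  (forall k g h, O (el 0 (2 * k) (2 * Posz n * g) (2 * Posz n * h))) ->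
  (m = d * n \/ m = 2 * (d * n))%N ->
  exists a b : rat,
     [/\ a != 0, b != 0, definite a b, has_discriminant a b D
       & exists2 O : set (quat a b), eichler_order O N
         & exists w1 w2 : quat a b,
             [/\ O w1, O w2, w1 ^+ 2 = - 1 & w2 ^+ 2 = - m%:R]].
Proof.
move=> disc eO OP mE; exists (-1), c%:~R; split=> //.
- by rewrite intr_eq0.
- exact: (lt0_definite c_neq0 ii jj ji).
exists O => //; exists i0;
  have natA (k : nat) : (- Posz k)%:~R%:A = - k%:R :> B.
  have -> : (- Posz k)%:~R = - k%:R :> rat by rewrite rmorphN.
  by rewrite scaleNr scaler_nat.
case: mE => ->; [exists j0 | exists l0]; split; rewrite ?expr2 ?ii //.
- exact: OP.
- exact: OP.
- by rewrite jj -natA PoszM.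
- exact: OP.
- exact: OP.
by rewrite ll -natA !PoszM mulrN.
Qed.

End Sufficiency.

Theorem theorem1p30 (D N m : nat) (hD : (0 < D)%N) (hN : (0 < N)%N)
    (sqfD : squarefree D) (sqfN : squarefree N) (copDN : coprime D N)
    (oddD : odd (size (primes D))) (hm : (1 < m)%N) (mDN : (m %| D * N)%N) :
  (exists a b : rat,
     [/\ a != 0%R, b != 0%R, definite a b, has_discriminant a b D
       & exists2 O : set (quat a b), eichler_order O N
         & exists w1 w2 : quat a b,
             [/\ O w1, O w2, (w1 ^+ 2 = - 1)%R & (w2 ^+ 2 = - m%:R)%R]])
  <->
  [/\ m = (D * N)%N \/ ((2 %| D * N)%N /\ m = (D * N %/ 2)%N),
      forall p : nat, p \in primes D -> p = 2 \/ p = 3 %[mod 4]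
    & forall q : nat, q \in primes N -> q = 2 \/ q = 1 %[mod 4]].
Proof.
split=> [[a [b [_ _ defab discD [O eO [w1 [w2 [Ow1 Ow2 w11 w22]]]]]]]|].
  have w22' : (w2 * w2 = (- m%:R)%:A)%R by rewrite -expr2 w22 scaleNr
    scaler_nat.
  rewrite expr2 in w11.
  exact: (eichler_pair_necessary hD hN sqfD sqfN copDN oddD hm mDN
           defab discD eO Ow1 Ow2 w11 w22').
case=> mE D3 N1.
have odd_primes (k r : nat) : 0 < k -> (forall p, p \in primes k ->
  p = 2 \/ p = r %[mod 4]) ->
    forall j, odd j -> (j %| k) -> forall p, p \in primes j -> p = r %[mod 4].
  move=> k0 kr j j_odd jk p; rewrite mem_primes => /and3P[pp _ pj].
  have [|p2|//] := kr p; first by rewrite mem_primes pp k0 (dvdn_trans pj).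
  by move: pj; rewrite p2 dvdn2 j_odd.
have odd2 k : odd k -> ~~ (2 %| Posz k)%Z by rewrite dvdzE /= dvdn2 => ->.
(* If 2 divides D, then d has an even number of primes and d N = 1 modulo 4: the algebra ramifies at
   2, and the lattice with odd x applies. *)
have [D2|D_odd] := boolP (2 %| D).
  have [d dE] := dvdnP D2; rewrite mulnC in dE; subst D.
  have d_odd : odd d.
    apply: contraT; rewrite -dvdn2 => d2; have := sqfD 2 isT.
    by rewrite (@dvdn_mul 2 2 2).
  have N_odd : odd N.
    by move: copDN; rewrite coprimeMl coprime2n => /andP[].
  have sqd : squarefree d by apply: squarefree_dvdr sqfD _; rewrite dvdn_mull.
  have copdN : coprime d N by move: copDN; rewrite coprimeMl => /andP[].
  have d3 := odd_primes _ _ hD D3 _ d_odd (dvdn_mull 2 (dvdnn d)).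
  have n1 := odd_primes _ _ hN N1 _ N_odd (dvdnn N).
  have m4 : (4 %| (Posz d * Posz N - 1)%R)%Z.
    have := mod4_prod d_odd N_odd sqd sqfN d3 n1.
    move: oddD; rewrite (perm_size (odd_double_primes d_odd)) /= => /negPf->.
    by rewrite -PoszM; clear; lia.
  have [x [xP x_odd]] := exists_sqrt_minus1 N_odd sqfN n1 false.
  have disc : has_discriminant (-1)%R ((- (Posz d * Posz N))%:~R)%R (2 * d).
    apply: pair_discriminant => // p pp; rewrite Euclid_dvdM // dvdn_prime2 //.
    split=> [/orP[/eqP p2|]|[->|[->]]]; rewrite ?orbT //; [by right | by left].
  have x2 : ~~ (2 %| x)%Z by rewrite x_odd.
  apply: (pair_construction d_odd N_odd disc).
  - apply: (@eichler_OII_flip (Posz d) N (odd2 _ N_odd) (odd2 _ d_odd) _ _ x x2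
    xP m4).
      by rewrite coprimezE coprime_sym.
    by apply: (@dvd_sum_squares d).
  - by move=> k g h; apply: OII_flip_pure => //; apply: odd2.
  by move: mE; clear; lia.
rewrite dvdn2 negbK in D_odd.
have d3 := odd_primes _ _ hD D3 _ D_odd (dvdnn D).
(* With D odd, D n = 3 modulo 4: the algebra splits at 2, and the lattice with even x applies,
   whether n is N or N / 2. *)
have m4 n : odd n -> squarefree n -> (forall p, p \in primes n ->
  p = 1 %[mod 4]) ->
    (4 %| (Posz D * Posz n + 1)%R)%Z.
  move=> n_odd sqn n1; have := mod4_prod D_odd n_odd sqfD sqn d3 n1.
  by rewrite oddD -PoszM; clear; lia.
have disc n : odd n -> squarefree n -> coprime D n ->
    (forall p, p \in primes n -> p = 1 %[mod 4]) ->
    has_discriminant (-1)%R ((- (Posz D * Posz n))%:~R)%R D.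
  move=> n_odd sqn copn n1; apply: pair_discriminant => // p pp.
  split=> [|[//|[_ m1]]]; first by left.
  by have := m4 n n_odd sqn n1; move: m1; clear; lia.
(* An even level is reached through [swap], which yields level 2 n; an odd one through [flip]. *)
have [N2|N_odd] := boolP (2 %| N).
  have [n nE] := dvdnP N2; rewrite mulnC in nE; subst N.
  have n_odd : odd n.
    apply: contraT; rewrite -dvdn2 => n2; have := sqfN 2 isT.
    by rewrite (@dvdn_mul 2 2 2).
  have sqn : squarefree n by apply: squarefree_dvdr sqfN _; rewrite dvdn_mull.
  have copn : coprime D n by move: copDN; rewrite coprimeMr => /andP[].
  have n1 := odd_primes _ _ hN N1 _ n_odd (dvdn_mull 2 (dvdnn n)).
  have [x [xP x2]] := exists_sqrt_minus1 n_odd sqn n1 true.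
  apply: (pair_construction D_odd n_odd (disc n n_odd sqn copn n1)).
  - apply: (@eichler_OI_swap (Posz D) n (odd2 _ n_odd) (odd2 _ D_odd) _ _ x x2
    xP (m4 n n_odd sqn n1)).
      by rewrite coprimezE coprime_sym.
    by apply: (@dvd_sum_squares D).
  - by move=> k g h; apply: OI_swap_pure => //; apply: odd2.
  by move: mE; clear; lia.
rewrite dvdn2 negbK in N_odd.
have n1 := odd_primes _ _ hN N1 _ N_odd (dvdnn N).
have [x [xP x2]] := exists_sqrt_minus1 N_odd sqfN n1 true.
apply: (pair_construction D_odd N_odd (disc N N_odd sqfN copDN n1)).
- apply: (@eichler_OI_flip (Posz D) N (odd2 _ N_odd) (odd2 _ D_odd) _ _ x x2 xP
  (m4 N N_odd sqfN n1)).
    by rewrite coprimezE coprime_sym.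
  by apply: (@dvd_sum_squares D).
- by move=> k g h; apply: OI_flip_pure => //; apply: odd2.
(* D N is odd, which excludes the second value of m. *)
by case: mE => [|[]]; [left | rewrite dvdn2 oddM D_odd N_odd].
Qed.
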